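(* Let $\Omega\subset\mathbb{R}^n$ be an open set with nonempty boundary and let $0<q<2$. Let $f,g:\mathbb{R}\to\mathbb{R}$ be nondecreasing continuous functions such that $f(-t)<0<f(t)$ for all $t>0$, at least one of $f$, $g$ is strictly increasing, and $g(t)\ge0$ for all $t>0$. Assume $$\int_1^\infty\frac{ds}{\sqrt{F(s)}+G(s)^{\frac1{2-q}}}<\infty,\qquad F(t):=\int_0^tf(s)\,ds,\quad G(t):=\int_0^tg(s)\,ds.$$ If $0<q\le1$, then every viscosity subsolution $u\in\mathrm{USC}(\Omega)$ of $$\Delta_\infty^Nu=f(u)+g(u)|Du|^q\quad\text{in }\Omega$$ satisfies $$u(x)\le\mathcal{Q}(d_\Omega(x)),\qquad x\in\Omega.$$ If $1<q<2$, the same estimate holds for every such subsolution provided that, in addition, $\lim_{t\to\infty}f(t)=\infty$ or $\lim_{t\to\infty}g(t)=\infty$.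
   Context: $d_\Omega(x)$ is the distance from $x$ to $\partial\Omega$; $\mathrm{USC}(\Omega)$ is the class of upper-semicontinuous real-valued functions on $\Omega$. Viscosity subsolutions: for $\phi$ of class $C^2$ near $x$, put $\Delta_\infty^{N,+}\phi(x):=|D\phi(x)|^{-2}\langle D^2\phi(x)D\phi(x),D\phi(x)\rangle$ if $D\phi(x)\ne0$, and $\Delta_\infty^{N,+}\phi(x):=\max\{\langle D^2\phi(x)e,e\rangle:|e|=1\}$ if $D\phi(x)=0$. A function $u\in\mathrm{USC}(\Omega)$ is a viscosity subsolution of the equation if, whenever $x_0\in\Omega$ and $\phi$ is $C^2$ near $x_0$ with $u-\phi$ having a local maximum at $x_0$, one has $\Delta_\infty^{N,+}\phi(x_0)\ge f(u(x_0))+g(u(x_0))|D\phi(x_0)|^q$. The constant $C(q)$: for $0<t<s$ write $\mathcal{F}(s,t):=F(s)-F(t)$ and $\mathcal{G}(s,t):=G(s)-G(t)$. For $a>0$ consider the initial-value problem $$\phi''(r)=f(\phi)+g(\phi)|\phi'|^q\ (r>0),\qquad \phi(0)=a,\ \phi'(0)=0.$$ $C(q)>0$ denotes a fixed constant depending only on $q$ such that, for all $f,g$ satisfying the monotonicity, continuity and sign hypotheses of the claim, all $a>0$, and every solution $\phi\in C^2([0,R))$ of this problem, $$C(q)\left(\sqrt{\mathcal{F}(\phi(r),a)}+\mathcal{G}(\phi(r),a)^{\frac1{2-q}}\right)\le\phi'(r),\qquad 0<r<R.$$ The functions $\Psi,\Phi,\mathcal{Q}$: define $$\Psi(t):=\frac1{C(q)}\int_t^\infty\frac{ds}{\sqrt{\mathcal{F}(s,t)}+\mathcal{G}(s,t)^{\frac1{2-q}}},\qquad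 t>0.$$ Under the hypotheses of the claim, $\Psi$ is finite, continuous and strictly decreasing on $(0,\infty)$ with $\lim_{t\to\infty}\Psi(t)=0$. Let $\Psi(0+):=\lim_{t\to0^+}\Psi(t)\in(0,\infty]$. Let $\Phi:(0,\Psi(0+))\to(0,\infty)$ be the (decreasing) inverse of $\Psi$, and when $\Psi(0+)<\infty$ set $\Phi(\Psi(0+)):=0$. Finally $$\mathcal{Q}(t):=\Phi(\min\{t,\Psi(0+)\}),\qquad t>0.$$ *)

(* Defs.v *)
From HB Require Import structures.
From mathcomp Require Import all_boot all_order all_algebra.
From mathcomp Require Import all_classical all_reals all_analysis.
Set Implicit Arguments.
Unset Strict Implicit.
Unset Printing Implicit Defensive.
Import Order.TTheory GRing.Theory Num.Theory.
Import numFieldNormedType.Exports.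
Local Open Scope classical_set_scope.
Local Open Scope ring_scope.

(* The canonical norm of 'rV[R]_n is the sup norm; it is used only through its
   topology. Lengths and distances are Euclidean, defined here. *)
Definition dotp (R : realType) (n : nat) (x y : 'rV[R]_n) : R :=
  \sum_(i < n) x 0 i * y 0 i.

Definition enorm (R : realType) (n : nat) (x : 'rV[R]_n) : R :=
  Num.sqrt (dotp x x).

Definition boundary (T : topologicalType) (A : set T) : set T :=
  closure A `\` interior A.

Definition dist_boundary (R : realType) (n : nat) (Omega : set 'rV[R]_n)
    (x : 'rV[R]_n) : R :=
  inf [set enorm (x - y) | y in boundary Omega].

Definition usc_on (R : realType) (n : nat) (Omega : set 'rV[R]_n)
    (u : 'rV[R]_n -> R) : Prop :=
  forall x, Omega x -> forall e : R, 0 < e ->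
    \forall y \near x, Omega y -> u y < u x + e.

Definition partial (R : realType) (n : nat) (i : 'I_n) (phi : 'rV[R]_n -> R) :
    'rV[R]_n -> R :=
  fun x => 'D_(delta_mx 0 i) phi x.

Definition C2_near (R : realType) (n : nat) (phi : 'rV[R]_n -> R)
    (x : 'rV[R]_n) : Prop :=
  \forall y \near x,
    [/\ {for y, continuous phi},
        forall i : 'I_n, derivable phi y (delta_mx 0 i) /\
                         {for y, continuous (partial i phi)}
      & forall i j : 'I_n, derivable (partial i phi) y (delta_mx 0 j) /\
                           {for y, continuous (partial j (partial i phi))}].

Definition gradient (R : realType) (n : nat) (phi : 'rV[R]_n -> R)
    (x : 'rV[R]_n) : 'rV[R]_n :=
  \row_i partial i phi x.

Definition hessian (R : realType) (n : nat) (phi : 'rV[R]_n -> R)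
    (x : 'rV[R]_n) : 'M[R]_n :=
  \matrix_(i, j) partial j (partial i phi) x.

Definition quad_form (R : realType) (n : nat) (H : 'M[R]_n) (e : 'rV[R]_n) : R :=
  dotp (e *m H^T) e.

(* For n >= 1 the supremum below is a maximum, the unit sphere being compact. *)
Definition inf_laplacian_plus (R : realType) (n : nat) (phi : 'rV[R]_n -> R)
    (x : 'rV[R]_n) : R :=
  if gradient phi x != 0 then
    enorm (gradient phi x) ^- 2 * quad_form (hessian phi x) (gradient phi x)
  else sup [set quad_form (hessian phi x) e | e in [set e | enorm e = 1]].

Definition viscosity_subsolution (R : realType) (n : nat) (f g : R -> R) (q : R)
    (Omega : set 'rV[R]_n) (u : 'rV[R]_n -> R) : Prop :=
  usc_on Omega u /\
  forall (x0 : 'rV[R]_n) (phi : 'rV[R]_n -> R),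
    Omega x0 -> C2_near phi x0 ->
    (\forall y \near x0, Omega y -> u y - phi y <= u x0 - phi x0) ->
    f (u x0) + g (u x0) * enorm (gradient phi x0) `^ q
      <= inf_laplacian_plus phi x0.

Definition nondecreasing_cont_sign (R : realType) (f g : R -> R) : Prop :=
  [/\ {homo f : s t / s <= t} /\ {homo g : s t / s <= t},
      continuous f /\ continuous g,
      forall t, 0 < t -> f (- t) < 0 /\ 0 < f t,
      {homo f : s t / s < t} \/ {homo g : s t / s < t}
    & forall t, 0 < t -> 0 <= g t].

(* t |-> \int_0^t h, oriented. *)
Definition primitive (R : realType) (h : R -> R) (t : R) : R :=
  if 0 <= t then \int[lebesgue_measure]_(s in `[0, t]) h s
  else - \int[lebesgue_measure]_(s in `[t, 0]) h s.

(* Applied to F s, G s this is the denominator in the Keller-Osserman condition;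
   applied to F s - F t, G s - G t it is the one in Psi. *)
Definition KO_denom (R : realType) (q x y : R) : R :=
  Num.sqrt x + y `^ (2 - q)^-1.

Definition keller_osserman (R : realType) (f g : R -> R) (q : R) : Prop :=
  (\int[lebesgue_measure]_(s in `[1%R, +oo[)
     ((KO_denom q (primitive f s) (primitive g s))^-1)%:E < +oo)%E.

Definition has_derivative_within (R : realType) (A : set R) (h : R -> R)
    (x l : R) : Prop :=
  (h y - h x) / (y - x) @[y --> within A x^'] --> l.

(* phi is C^2 on [0, r0), with derivatives phi1 and phi2 (one-sided at 0). *)
Definition ivp_solution (R : realType) (f g : R -> R) (q a r0 : R)
    (phi phi1 phi2 : R -> R) : Prop :=
  [/\ forall r, 0 <= r < r0 -> has_derivative_within `[0, r0[ phi r (phi1 r),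
      forall r, 0 <= r < r0 -> has_derivative_within `[0, r0[ phi1 r (phi2 r),
      {within `[0, r0[, continuous phi2},
      forall r, 0 < r < r0 -> phi2 r = f (phi r) + g (phi r) * `|phi1 r| `^ q
    & phi 0 = a /\ phi1 0 = 0].

Definition gradient_bound_constant (R : realType) (q C : R) : Prop :=
  0 < C /\
  forall f g : R -> R, nondecreasing_cont_sign f g ->
  forall (a r0 : R) (phi phi1 phi2 : R -> R), 0 < a -> 0 < r0 ->
    ivp_solution f g q a r0 phi phi1 phi2 ->
  forall r, 0 < r < r0 ->
    C * KO_denom q (primitive f (phi r) - primitive f a)
                   (primitive g (phi r) - primitive g a) <= phi1 r.

Definition Psi (R : realType) (f g : R -> R) (q C t : R) : \bar R :=
  ((C^-1)%:E * \int[lebesgue_measure]_(s in `]t, +oo[)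
     ((KO_denom q (primitive f s - primitive f t)
                  (primitive g s - primitive g t))^-1)%:E)%E.

Definition Psi0 (R : realType) (f g : R -> R) (q C : R) : \bar R :=
  lim (Psi f g q C t @[t --> 0^'+]).

(* Inverse of Psi on ]0, Psi0[, extended by 0 at Psi0. *)
Definition Phi (R : realType) (f g : R -> R) (q C : R) (y : \bar R) : R :=
  if y == Psi0 f g q C then 0
  else xget 0 [set s | 0 < s /\ Psi f g q C s = y].

Definition calQ (R : realType) (f g : R -> R) (q C t : R) : R :=
  Phi f g q C (Order.min t%:E (Psi0 f g q C)).

(* Main.v *)
Require Import Defs.
From HB Require Import structures.
From mathcomp Require Import all_boot all_order all_algebra.
From mathcomp Require Import all_classical all_reals all_analysis.
From mathcomp Require Import measurable_realfun ring lra.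
Set Implicit Arguments.
Unset Strict Implicit.
Unset Printing Implicit Defensive.
Import Order.TTheory GRing.Theory Num.Theory.
Import numFieldNormedType.Exports.
Local Open Scope classical_set_scope.
Local Open Scope ring_scope.

(** The proof compares [u] with radial solutions that blow up inside [Omega].

    Let [d] be the distance from [x] to the boundary and let [a > 0] satisfy
    [Psi a < d]. For [0 < m < 1] the pair [m ^ 2 * f, g] satisfies the same
    hypotheses as [f, g], so the gradient bound with constant [C] applies to the
    solution [phi] of the initial value problem for this pair with value [a] at
    [0]. Separating variables, [phi] exceeds any given level before the radius
    [Psi a / m] ([blowup_radius_le]), and this radius is below [d] for [m] close
    to [1]. The upper semicontinuous [u] is bounded above on the closed ball of
    that radius around [x], so once [phi] has passed this bound, the function
    [u - phi (|y - x|)] is negative on a sphere. If it were positive at the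
    center, it would have a positive interior maximum, where the subsolution
    property gives
    [f u + g u * |phi'| ^ q <= m ^ 2 * f phi + g phi * |phi'| ^ q] with
    [u > phi > 0]. This is absurd since [f] and [g] are nondecreasing and
    [f phi > 0] ([comparison]); the factor [m ^ 2 < 1] is what makes the
    comparison strict at the center, where [phi'] vanishes. Hence [u x <= a]
    whenever [Psi a < d] ([subsolution_le]).

    The solution [phi] comes from the first-order equation satisfied by
    [phi' ^ 2] as a function of [phi], namely [Y' = 2 f + 2 g Y ^ (q / 2)]. As
    [q / 2 < 1] it is sublinear, hence has a solution on the whole half-line, the
    limit of a monotone iteration ([sublinear_ode_exists]); integrating
    [1 / sqrt Y] recovers the radius as a function of [phi] ([ivp_exists]).

    What remains is to invert [Psi]. Written over the half-line of [s - t], its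
    integrand decreases strictly in [t] and depends continuously on it, so [Psi]
    is strictly decreasing, and by dominated convergence it is continuous and
    tends to [0] at infinity as soon as [f] or [g] is unbounded ([psi_decr],
    [psi_continuous], [psi_small]). For [q <= 1] unboundedness follows from the
    Keller-Osserman condition ([KO_unbounded]); for [q > 1] it is assumed. If
    [d < Psi0], then [Psi s = d] for some [s] and [u x <= a] for every [a > s];
    otherwise [u x <= a] for every [a > 0]. *)

(** * Real analysis on the line *)

Lemma is_derive_continuous (R : realType) (f : R -> R) (x a : R) :
  is_derive x 1 f a -> {for x, continuous f}.
Proof.
by move=> [/derivable1_diffP df _]; exact: differentiable_continuous.
Qed.

Lemma is_derive_within_continuous (R : realType) (f df : R -> R) (A : set R) :
  (forall x, A x -> is_derive x 1 f (df x)) -> {within A, continuous f}.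
Proof.
move=> dfA; apply: continuous_in_subspaceT => x /set_mem Ax.
exact: is_derive_continuous (dfA _ Ax).
Qed.

(** Monotonicity from a derivative given as an [is_derive] fact, so that no
    [derive1] has to be computed. *)
Lemma is_derive_ndecr (R : realType) (f df : R -> R) (a b : R) : a <= b ->
  (forall x, a < x < b -> is_derive x 1 f (df x)) ->
  (forall x, a < x < b -> 0 <= df x) ->
  {within `[a, b], continuous f} -> f a <= f b.
Proof.
rewrite le_eqVlt => /predU1P[-> //|ab] dfE df0 cf.
have dfE' x : x \in `]a, b[%R -> is_derive x 1 f (df x).
  by rewrite in_itv /= => /dfE.
have [c cab E] := MVT ab dfE' cf.
rewrite -subr_ge0 E mulr_ge0 ?subr_ge0 ?(ltW ab)// df0//.
Qed.

Lemma is_derive_incr (R : realType) (f df : R -> R) (a b : R) : a < b ->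
  (forall x, a < x < b -> is_derive x 1 f (df x)) ->
  (forall x, a < x < b -> 0 < df x) ->
  {within `[a, b], continuous f} -> f a < f b.
Proof.
move=> ab dfE df0 cf.
have dfE' x : x \in `]a, b[%R -> is_derive x 1 f (df x).
  by rewrite in_itv /= => /dfE.
have [c cab E] := MVT ab dfE' cf.
rewrite -subr_gt0 E mulr_gt0 ?subr_gt0// df0//.
Qed.

Lemma continuous_itv_integrable (R : realType) (h : R -> R) (a b : R) :
  continuous h -> (@lebesgue_measure R).-integrable `[a, b] (EFin \o h).
Proof.
move=> ch; apply: continuous_compact_integrable; first exact: segment_compact.
exact: continuous_subspaceT.
Qed.

(** Moving the base point to the left turns the oriented integral from [0] into
    a difference of integrals over intervals starting at one point [N], to
    which the fundamental theorem of calculus applies on both sides of [0]. *)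
Lemma primitive_split (R : realType) (h : R -> R) (N t : R) :
  continuous h -> N <= 0 -> N <= t ->
  primitive h t = \int[lebesgue_measure]_(s in `[N, t]) h s
                  - \int[lebesgue_measure]_(s in `[N, 0]) h s.
Proof.
move=> ch N0 Nt.
have split a b c : a <= b -> b <= c ->
    \int[@lebesgue_measure R]_(s in `[a, c]) h s
    = \int[@lebesgue_measure R]_(s in `[a, b]) h s
    + \int[@lebesgue_measure R]_(s in `[b, c]) h s.
  move=> ab bc.
  have := @Rintegral_itvB R h (BLeft a) (BRight c) b
    (continuous_itv_integrable a c ch).
  rewrite !bnd_simp => /(_ ab bc)/eqP; rewrite subr_eq addrC => /eqP ->.
  congr (_ + _); apply: Rintegral_itv_obnd_cbnd.
  apply: (integrableS _ _ _ (continuous_itv_integrable b c ch)) => //.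
  exact: subset_itv_oc_cc.
rewrite /primitive; case: ifPn => [t0|].
  by rewrite (split N 0 t)// addrAC subrr add0r.
by rewrite -ltNge => /ltW t0; rewrite (split N t 0)// opprD addrA subrr add0r.
Qed.

Lemma is_derive_primitive (R : realType) (h : R -> R) (x : R) :
  continuous h -> is_derive x 1 (primitive h) (h x).
Proof.
move=> ch.
(* any base point to the left of both 0 and x works *)
pose N := - `|x| - 1.
have N0 : N <= 0 by rewrite /N; have := normr_ge0 x; lra.
have Nx : N < x by rewrite /N; have := ler_norm (- x); rewrite normrN; lra.
pose I t := \int[@lebesgue_measure R]_(s in `[N, t]) h s.
have dI : is_derive x 1 I (h x).
  have x1 : x < x + 1 by rewrite ltrDl.
  have [dI E] := @continuous_FTC1_closed R h N x (x + 1) x1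
    (continuous_itv_integrable N (x + 1) ch) Nx (ch x).
  by split; [exact: dI | rewrite -derive1E; exact: E].
apply: (@near_eq_is_derive _ _ _ (fun t => I t - I 0)).
  near=> t; rewrite (@primitive_split _ _ N)//.
  by apply/ltW; near: t; exact: lt_nbhsr.
have := @is_deriveB R _ _ I (cst (I 0)) x 1 (h x) 0 dI (is_derive_cst _ _ _).
by rewrite subr0.
Unshelve. all: by end_near. Qed.

Lemma primitive0 (R : realType) (h : R -> R) : primitive h 0 = 0.
Proof. by rewrite /primitive lexx set_itv1 Rintegral_set1. Qed.

Lemma continuous_primitive (R : realType) (h : R -> R) :
  continuous h -> continuous (primitive h).
Proof. by move=> ch x; exact: is_derive_continuous (is_derive_primitive _ ch). Qed.

(** The absolute value is there because [powR] jumps to [1] on negative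
    arguments. *)
Lemma continuous_norm_powR (R : realType) (p : R) :
  0 < p -> continuous (fun y : R => `|y| `^ p).
Proof.
move=> p0 y; have [->|y0] := eqVneq y 0; last first.
  apply: (@continuous_comp _ _ _ (fun y : R => `|y|) (@powR R ^~ p)).
    exact: norm_continuous.
  by apply/differentiable_continuous/derivable1_diffP/derivable_powR; rewrite in_itv/= normr_gt0 y0.
rewrite /continuous_at normr0 powR0 ?gt_eqF//.
apply/cvgrPdist_lt => e e0.
have p_neq0 : p != 0 by rewrite gt_eqF.
suff : \forall z \near (0 : R), `|z| < e `^ p^-1.
  apply: filterS => z ze.
  rewrite sub0r normrN ger0_norm ?powR_ge0//.
  rewrite -[ltRHS](@powRr1 _ e) ?(ltW e0)// -(mulVf p_neq0) powRrM.
  by rewrite gt0_ltr_powR// ?nnegrE ?powR_ge0.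
by apply: (@pseudometric_normed_Zmodule.nbhs0_lt _ R); exact: powR_gt0.
Qed.

Lemma continuous_EFin_measurable (R : realType) (D : set R) (h : R -> R) :
  continuous h -> measurable_fun D (EFin \o h).
Proof.
move=> ch; apply/measurable_EFinP; apply: measurable_funTS.
exact: continuous_measurable_fun.
Qed.

Lemma is_derive_sqr (R : realType) (f : R -> R) (x d : R) :
  is_derive x 1 f d -> is_derive x 1 (fun t => f t ^+ 2) (2 * f x * d).
Proof.
move=> df; have H := @is_deriveX R R f 2 x 1 d df.
rewrite (_ : (fun t => f t ^+ 2) = f ^+ 2); last first.
  by apply/funext => t; rewrite !expr2.
by apply: is_derive_eq; rewrite /GRing.scale /= expr1.
Qed.

Lemma is_derive_add_cst (R : realType) (f : R -> R) (c x d : R) :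
  is_derive x 1 f d -> is_derive x 1 (fun t => c + f t) d.
Proof.
move=> df; have H := @is_deriveD R _ _ (cst c) f x 1 0 d (is_derive_cst _ _ _) df.
by rewrite add0r in H.
Qed.

(** * A sublinear scalar equation *)

(** The equation [Y' = p + w Y ^ th] with [Y 0 = 0] on the half-line. Its
    right-hand side need not be Lipschitz in [Y] at [0], so the solution is
    obtained as the increasing limit of the iterates
    [Y |-> \int_0^x (p + w Y ^ th)] started at [0]. *)
Section sublinear_ode.
Context (R : realType) (p w : R -> R) (th : R).
Hypotheses (cp : continuous p) (cw : continuous w).
Hypotheses (ndp : {homo p : x y / x <= y}) (ndw : {homo w : x y / x <= y}).
Hypotheses (p0 : forall x : R, 0 <= x -> 0 <= p x).
Hypotheses (w0 : forall x : R, 0 <= x -> 0 <= w x).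
Hypotheses (th0 : 0 < th) (th1 : th < 1).

Definition ode_rhs (y : R -> R) (s : R) : R := p s + w s * `|y s| `^ th.

Definition ode_iter (k : nat) : R -> R :=
  iter k (fun y => primitive (ode_rhs y)) (cst 0).

Lemma continuous_ode_rhs (y : R -> R) : continuous y -> continuous (ode_rhs y).
Proof.
move=> cy x; apply: cvgD; first exact: cp.
apply: cvgM; first exact: cw.
apply: (@continuous_comp _ _ _ y (fun z : R => `|z| `^ th)); first exact: cy.
exact: continuous_norm_powR.
Qed.

Lemma continuous_ode_iter k : continuous (ode_iter k).
Proof.
elim: k => [|k IH] /=; first by move=> x; exact: cvg_cst.
by apply: continuous_primitive; exact: continuous_ode_rhs.
Qed.

Lemma is_derive_ode_iter k (x : R) :
  is_derive x 1 (ode_iter k.+1) (ode_rhs (ode_iter k) x).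
Proof.
by apply: is_derive_primitive; apply: continuous_ode_rhs; exact: continuous_ode_iter.
Qed.

Lemma ode_rhs_ge0 (y : R -> R) (s : R) : 0 <= s -> 0 <= ode_rhs y s.
Proof. by move=> s0; rewrite addr_ge0 ?p0// mulr_ge0 ?w0// powR_ge0. Qed.

Lemma ode_iter0 k : ode_iter k 0 = 0.
Proof. by case: k => [//|k]; exact: primitive0. Qed.

Lemma ode_iter_ge0 k (x : R) : 0 <= x -> 0 <= ode_iter k x.
Proof.
case: k => [//|k] x0; rewrite -(ode_iter0 k.+1).
apply: (is_derive_ndecr x0 (df := ode_rhs (ode_iter k))) => [y _|y|].
- exact: is_derive_ode_iter.
- by move=> /andP[/ltW y0 _]; exact: ode_rhs_ge0.
- by apply: continuous_subspaceT; exact: continuous_ode_iter.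
Qed.

(** Comparing the iterates through their derivatives: the right-hand side is
    nondecreasing in the unknown, which is what makes the iteration monotone. *)
Lemma le_ode_iterS k (x : R) : 0 <= x -> ode_iter k x <= ode_iter k.+1 x.
Proof.
elim: k x => [|k IH] x x0; first by have := ode_iter_ge0 1 x0.
pose D x := ode_iter k.+2 x - ode_iter k.+1 x.
have D0 : D 0 = 0 by rewrite /D !ode_iter0 subrr.
rewrite -subr_ge0 -[leLHS]D0.
apply: (is_derive_ndecr x0 (f := D)
  (df := fun x => ode_rhs (ode_iter k.+1) x - ode_rhs (ode_iter k) x)) => [y _|y|].
- by apply: is_deriveB; exact: is_derive_ode_iter.
- move=> /andP[/ltW y0 _]; rewrite subr_ge0 lerD2l ler_wpM2l ?w0//.
  rewrite ge0_ler_powR ?(ltW th0)// ?nnegrE//.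
  by rewrite !ger0_norm ?ode_iter_ge0// IH.
- apply: continuous_subspaceT => y.
  by apply: cvgB; exact: continuous_ode_iter.
Qed.

(** Sublinearity gives a constant supersolution on each bounded interval. *)
Lemma ode_apriori (M : R) : 0 <= M ->
  exists2 K, 0 <= K & M * (p M + w M * K `^ th) <= K.
Proof.
move=> M0.
pose A := Num.max 1 (M * (p M + w M)).
have A1 : 1 <= A by rewrite le_max lexx.
have A0 : 0 <= A by exact: le_trans A1.
have th10 : 0 < 1 - th by rewrite subr_gt0.
pose K := A `^ (1 - th)^-1.
have KA : K `^ (1 - th) = A by rewrite -powRrM mulVf ?gt_eqF// powRr1.
have pge1 (r y : R) : 0 <= r -> 1 <= y -> 1 <= y `^ r.
  move=> r0 y1; have := @ge0_ler_powR R r r0 1 y.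
  by rewrite powR1 !nnegrE ler01 (le_trans ler01 y1); exact.
have K1 : 1 <= K `^ th.
  by apply: (pge1); [exact: ltW|apply: pge1 => //; rewrite invr_ge0 ltW].
exists K; first exact: powR_ge0.
apply: (@le_trans _ _ (M * (p M + w M) * K `^ th)).
  rewrite -mulrA ler_wpM2l// mulrDl lerD2r ler_peMr// p0//.
apply: (@le_trans _ _ (A * K `^ th)).
  by rewrite ler_wpM2r ?powR_ge0// le_max lexx orbT.
rewrite -KA -powRD; last by rewrite subrK oner_eq0.
by rewrite subrK powRr1// powR_ge0.
Qed.

(** The constant supersolution bounds the iterates, hence their slopes. *)
Lemma ode_iter_bound (M K : R) : 0 <= M -> 0 <= K ->
  M * (p M + w M * K `^ th) <= K ->
  forall k (x : R), 0 <= x <= M -> ode_rhs (ode_iter k) x <= p M + w M * K `^ th.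
Proof.
move=> M0 K0 MK k x xM.
suff H : ode_iter k x <= K.
  have /andP[x0 xM'] := xM.
  rewrite lerD ?ndp// ler_pM ?w0 ?powR_ge0 ?ndw//.
  by rewrite ge0_ler_powR ?(ltW th0)// ?nnegrE// ger0_norm// ode_iter_ge0.
elim: k x xM => [//|k IH] x /andP[x0 xM].
apply: le_trans MK.
set B := (X in M * X).
have B0 : 0 <= B by rewrite addr_ge0 ?p0// mulr_ge0 ?w0// powR_ge0.
apply: (@le_trans _ _ (x * B)); last by rewrite ler_wpM2r.
pose D x := x * B - ode_iter k.+1 x.
have D0 : D 0 = 0 by rewrite /D mul0r ode_iter0 subr0.
rewrite -subr_ge0 -[leLHS]D0.
apply: (is_derive_ndecr x0 (f := D)
  (df := fun x => B - ode_rhs (ode_iter k) x)) => [y _|y|].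
- apply: is_deriveB; last exact: is_derive_ode_iter.
  have := @is_deriveM R _ id (cst B) y 1 1 0 (is_derive_id _ _) (is_derive_cst _ _ _).
  by rewrite scaler0 add0r /GRing.scale /= mulr1.
- move=> /andP[/ltW y0 yx].
  have yM : y <= M by rewrite (le_trans (ltW yx)).
  rewrite subr_ge0 lerD ?ndp// ler_pM ?w0 ?powR_ge0 ?ndw//.
  rewrite ge0_ler_powR ?(ltW th0)// ?nnegrE// ger0_norm ?ode_iter_ge0//.
  by rewrite IH// y0.
- apply: continuous_subspaceT => y.
  apply: cvgB; last exact: continuous_ode_iter.
  by apply: cvgM; [exact: cvg_id|exact: cvg_cst].
Qed.

Lemma ode_iter_lip (M K : R) : 0 <= M -> 0 <= K ->
  M * (p M + w M * K `^ th) <= K ->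
  forall k (x y : R), 0 <= x -> x <= y -> y <= M ->
  ode_iter k x <= ode_iter k y <= ode_iter k x + (p M + w M * K `^ th) * (y - x).
Proof.
move=> M0 K0 MK k x y x0 xy yM.
set B := p M + _.
have B0 : 0 <= B by rewrite addr_ge0 ?p0// mulr_ge0 ?w0// powR_ge0.
case: k => [|k]; first by rewrite /= lexx add0r mulr_ge0// subr_ge0.
have [c cxy E] := MVT_segment xy
  (fun z _ => is_derive_ode_iter k z)
  (continuous_subspaceT (@continuous_ode_iter k.+1)).
move: cxy; rewrite in_itv /= => /andP[xc cy].
rewrite -subr_ge0 E mulr_ge0 ?subr_ge0// ?ode_rhs_ge0 ?(le_trans x0)//=.
rewrite -lerBlDl E ler_wpM2r ?subr_ge0//.
by apply: ode_iter_bound => //; rewrite (le_trans x0 xc)/= (le_trans cy).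
Qed.

(** Extending the limit evenly to the whole line makes its continuity at [0]
    two-sided, as needed to differentiate its integral there. *)
Definition ode_lim (x : R) : R := limn (fun k => ode_iter k `|x|).

Lemma ode_iter_cvg (x : R) : ode_iter k `|x| @[k --> \oo] --> ode_lim x.
Proof.
have [K K0 MK] := ode_apriori (normr_ge0 x).
apply: nondecreasing_is_cvgn.
  apply/nondecreasing_seqP => k; exact: le_ode_iterS.
exists (0 + (p `|x| + w `|x| * K `^ th) * (`|x| - 0)) => _ [k _ <-].
rewrite -[X in _ <= X + _](ode_iter0 k).
by case/andP: (ode_iter_lip (normr_ge0 x) K0 MK k (lexx 0) (normr_ge0 x) (lexx _)).
Qed.

Lemma ode_lim_ge0 (x : R) : 0 <= ode_lim x.
Proof.
apply: (cvgr_to_ge (@ode_iter_cvg x)).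
by apply: nearW => k; exact: ode_iter_ge0.
Qed.

(** The slopes of the iterates are bounded uniformly on bounded intervals, and
    a uniform Lipschitz bound survives the pointwise limit. *)
Lemma continuous_ode_lim : continuous ode_lim.
Proof.
move=> x.
pose M := `|x| + 1.
have M0 : 0 <= M by rewrite addr_ge0.
have [K K0 MK] := ode_apriori M0.
set B := p M + w M * K `^ th in MK.
have B0 : 0 <= B by rewrite addr_ge0 ?p0// mulr_ge0 ?w0// powR_ge0.
have lip y z : `|y| <= `|z| -> `|z| <= M ->
    `|ode_lim z - ode_lim y| <= B * (`|z| - `|y|).
  move=> yz zM; rewrite ler_norml; apply/andP; split.
    apply: (@le_trans _ _ 0).
      by rewrite oppr_le0 mulr_ge0// subr_ge0.
    apply: (cvgr_to_ge (cvgB (@ode_iter_cvg z) (@ode_iter_cvg y))).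
    apply: nearW => k; rewrite subr_ge0.
    by case/andP: (ode_iter_lip M0 K0 MK k (normr_ge0 y) yz zM).
  apply: (cvgr_to_le (cvgB (@ode_iter_cvg z) (@ode_iter_cvg y))).
  apply: nearW => k; rewrite lerBlDl.
  by case/andP: (ode_iter_lip M0 K0 MK k (normr_ge0 y) yz zM).
have lip2 y z : `|y| <= M -> `|z| <= M ->
    `|ode_lim z - ode_lim y| <= B * `|z - y|.
  move=> yM zM; have [yz|/ltW zy] := leP `|y| `|z|.
    apply: (le_trans (lip _ _ yz zM)).
    by rewrite ler_wpM2l// lerB_dist.
  rewrite (distrC (ode_lim z)) (distrC z).
  apply: (le_trans (lip _ _ zy yM)).
  by rewrite ler_wpM2l// lerB_dist.
apply/cvgrPdist_lt => e e0.
have B1 : 0 < B + 1 by rewrite ltr_pwDr.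
have eB : 0 < e / (B + 1) by rewrite divr_gt0.
apply: filterS2 (nbhsx_ballx x _ ltr01) (nbhsx_ballx x _ eB) => z /ltW x1 xz.
have zM : `|z| <= M.
  by move: x1; rewrite distrC /M -lerBlDl; apply: le_trans; exact: lerB_dist.
have xM : `|x| <= M by rewrite /M lerDl.
apply: le_lt_trans (lip2 _ _ zM xM) _.
move: xz; rewrite /ball /= ltr_pdivlMr// mulrC; apply: le_lt_trans.
by rewrite ler_wpM2r// lerDl.
Qed.

(** The limit is a fixed point of the iteration, by dominated convergence. *)
Lemma primitive_ode_lim (x : R) : 0 <= x -> primitive (ode_rhs ode_lim) x = ode_lim x.
Proof.
move=> x0.
have [K K0 MK] := ode_apriori x0.
set B := p x + w x * K `^ th in MK.
have cvgp : ode_iter k.+1 x @[k --> \oo] --> primitive (ode_rhs ode_lim) x.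
  rewrite /= /primitive x0 /Rintegral.
  have [|||||_ _ H] := @dominated_convergence _ _ R lebesgue_measure `[0, x]
    (measurable_itv _) (fun k s => (ode_rhs (ode_iter k) s)%:E)
    (fun s => (ode_rhs ode_lim s)%:E) (cst B%:E).
  - move=> k; apply: continuous_EFin_measurable.
    by apply: continuous_ode_rhs; exact: continuous_ode_iter.
  - apply: continuous_EFin_measurable.
    by apply: continuous_ode_rhs; exact: continuous_ode_lim.
  - apply: aeW => s /=; rewrite in_itv /= => /andP[s0 sx].
    apply/fine_cvgP; split; first exact: nearW.
    apply: cvgD; first exact: cvg_cst.
    apply: cvgM; first exact: cvg_cst.
    have := @ode_iter_cvg s; rewrite (ger0_norm s0) => cs.
    exact: (continuous_cvg _ (@continuous_norm_powR R th th0 (ode_lim s)) cs).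
  - by apply: (@continuous_itv_integrable _ (cst B)) => y; exact: cvg_cst.
  - apply: aeW => s /= k; rewrite in_itv /= => /andP[s0 sx].
    rewrite lee_fin ger0_norm ?ode_rhs_ge0//.
    by apply: (@ode_iter_bound x K) => //; rewrite s0.
  apply: fine_cvg; move: H; rewrite fineK//.
  apply: integrable_fin_num => //; apply: continuous_itv_integrable.
  by apply: continuous_ode_rhs; exact: continuous_ode_lim.
have := @ode_iter_cvg x; rewrite (ger0_norm x0) -cvg_shiftS.
by apply: cvg_unique.
Qed.

Lemma sublinear_ode_exists : exists Y : R -> R,
  [/\ Y 0 = 0, continuous Y, forall x : R, 0 <= x -> 0 <= Y x
    & forall x : R, 0 <= x -> is_derive x 1 Y (p x + w x * Y x `^ th)].
Proof.
have cr := continuous_ode_rhs continuous_ode_lim.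
exists (primitive (ode_rhs ode_lim)); split.
- exact: primitive0.
- exact: continuous_primitive.
- by move=> x x0; rewrite primitive_ode_lim// ode_lim_ge0.
- move=> x x0; rewrite primitive_ode_lim// -[X in X `^ _](ger0_norm (ode_lim_ge0 x)).
  exact: is_derive_primitive.
Qed.

End sublinear_ode.

(** * Solutions of the initial value problem *)

Section denominator.
Context (R : realType) (f g : R -> R) (q : R).
Hypotheses (q2 : q < 2) (fg : nondecreasing_cont_sign f g).

Let cf : continuous f. Proof. by case: fg => _ []. Qed.
Let cg : continuous g. Proof. by case: fg => _ []. Qed.
Let f0 (t : R) : 0 < t -> 0 < f t. Proof. by case: fg => _ _ + _ _ => /[apply] -[]. Qed.
Let g0 (t : R) : 0 < t -> 0 <= g t. Proof. by case: fg => _ _ _ _; apply. Qed.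

Lemma KO_exponent_gt0 : 0 < (2 - q)^-1.
Proof. by rewrite invr_gt0 subr_gt0. Qed.

Lemma primitive_f_incr (s t : R) : 0 <= t -> t < s -> primitive f t < primitive f s.
Proof.
move=> t0 ts; apply: (is_derive_incr ts (df := f)) => [x _|x /andP[tx _]|].
- exact: is_derive_primitive.
- by apply: f0; exact: le_lt_trans tx.
- by apply: continuous_subspaceT; exact: continuous_primitive.
Qed.

Lemma primitive_g_ndecr (s t : R) : 0 <= t -> t <= s -> primitive g t <= primitive g s.
Proof.
move=> t0 ts; apply: (is_derive_ndecr ts (df := g)) => [x _|x /andP[tx _]|].
- exact: is_derive_primitive.
- by apply: g0; exact: le_lt_trans tx.
- by apply: continuous_subspaceT; exact: continuous_primitive.
Qed.

Lemma KO_denom_gt0 (x y : R) : 0 < x -> 0 < KO_denom q x y.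
Proof. by move=> x0; rewrite ltr_pwDl ?sqrtr_gt0// powR_ge0. Qed.

Lemma KO_denom_increment_gt0 (s t : R) : 0 <= t -> t < s ->
  0 < KO_denom q (primitive f s - primitive f t) (primitive g s - primitive g t).
Proof. by move=> t0 ts; apply: KO_denom_gt0; rewrite subr_gt0 primitive_f_incr. Qed.

Lemma KO_denom_cvg T (F : set_system T) (FF : Filter F) (x y : T -> R) (lx ly : R) :
  (\forall t \near F, 0 <= y t) -> 0 <= ly -> x @ F --> lx -> y @ F --> ly ->
  KO_denom q (x t) (y t) @[t --> F] --> KO_denom q lx ly.
Proof.
move=> y0 ly0 xl yl; apply: cvgD.
  exact: (continuous_cvg FF (@sqrt_continuous R lx) xl).
have [p_gt0 c0] := (KO_exponent_gt0, @continuous_norm_powR R (2 - q)^-1).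
rewrite -[X in X `^ _](ger0_norm ly0).
have H := continuous_cvg FF (c0 p_gt0 ly) yl.
have E : {near F, (fun z => `|z| `^ (2 - q)^-1) \o y =1 (fun t => y t `^ (2 - q)^-1)}.
  by apply: filterS y0 => t y0; rewrite /= ger0_norm.
exact: cvg_trans (@near_eq_cvg _ _ F FF _ _ E) H.
Qed.

Lemma le_KO_denom (x x' y y' : R) : x <= x' -> 0 <= y -> y <= y' ->
  KO_denom q x y <= KO_denom q x' y'.
Proof.
move=> xx y0 yy; rewrite lerD ?ler_wsqrtr//.
by rewrite ge0_ler_powR ?nnegrE ?(ltW KO_exponent_gt0)// (le_trans y0).
Qed.

Lemma is_derive_primitive_shift (h : R -> R) (c x : R) : continuous h ->
  is_derive x 1 (fun x => primitive h (c + x)) (h (c + x)).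
Proof.
move=> ch; rewrite -[h _]mulr1.
apply: (@is_derive1_comp R (primitive h) (fun x => c + x)).
  exact: is_derive_primitive.
by apply: is_derive_add_cst; exact: is_derive_id.
Qed.

(** An increment of the primitive of a nondecreasing function over a step [s]
    grows with its base point: its derivative in [s] does. *)
Lemma increment_ndecr (h : R -> R) (t t' s : R) : continuous h ->
  {homo h : x y / x <= y} -> t <= t' -> 0 <= s ->
  primitive h (t + s) - primitive h t <= primitive h (t' + s) - primitive h t'.
Proof.
move=> ch ndh tt' s0.
pose D x := primitive h (t' + x) - primitive h (t + x).
pose dD x := h (t' + x) - h (t + x).
have dDE (x : R) : is_derive x 1 D (dD x).
  by apply: is_deriveB; exact: is_derive_primitive_shift.
suff : D 0 <= D s by rewrite /D !addr0; lra.
apply: (is_derive_ndecr s0 (df := dD)) => // [x _|].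
  by rewrite subr_ge0 ndh// lerD2r.
by apply: (is_derive_within_continuous (df := dD)) => x _.
Qed.

Lemma increment_incr (h : R -> R) (t t' s : R) : continuous h ->
  {homo h : x y / x < y} -> t < t' -> 0 < s ->
  primitive h (t + s) - primitive h t < primitive h (t' + s) - primitive h t'.
Proof.
move=> ch ih tt' s0.
pose D x := primitive h (t' + x) - primitive h (t + x).
pose dD x := h (t' + x) - h (t + x).
have dDE (x : R) : is_derive x 1 D (dD x).
  by apply: is_deriveB; exact: is_derive_primitive_shift.
suff : D 0 < D s by rewrite /D !addr0; lra.
apply: (is_derive_incr s0 (df := dD)) => // [x _|].
  by rewrite subr_gt0 ih// ltrD2r.
by apply: (is_derive_within_continuous (df := dD)) => x _.
Qed.

Lemma increment_ge (h : R -> R) (t s : R) : continuous h ->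
  {homo h : x y / x <= y} -> 0 <= s ->
  h t * s <= primitive h (t + s) - primitive h t.
Proof.
move=> ch ndh s0.
have ts : t <= t + s by rewrite lerDl.
have [c cts ->] := MVT_segment ts (fun z _ => is_derive_primitive z ch)
  (continuous_subspaceT (continuous_primitive ch)).
move: cts; rewrite in_itv /= => /andP[tc _].
by rewrite addrAC subrr add0r ler_wpM2r// ndh.
Qed.

Lemma increment_g_ge0 (t s : R) : 0 <= t -> 0 <= s ->
  0 <= primitive g (t + s) - primitive g t.
Proof. by move=> t0 s0; rewrite subr_ge0 primitive_g_ndecr// lerDl. Qed.

End denominator.

Section existence.
Context (R : realType) (f g : R -> R) (q a : R).
Hypotheses (q0 : 0 < q) (q2 : q < 2) (fg : nondecreasing_cont_sign f g).
Hypothesis (a0 : 0 < a).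

Let ndf : {homo f : s t / s <= t}. Proof. by case: fg => -[]. Qed.
Let ndg : {homo g : s t / s <= t}. Proof. by case: fg => -[]. Qed.
Let cf : continuous f. Proof. by case: fg => _ []. Qed.
Let cg : continuous g. Proof. by case: fg => _ []. Qed.
Let f0 (t : R) : 0 < t -> 0 < f t. Proof. by case: fg => _ _ + _ _ => /[apply] -[]. Qed.
Let g0 (t : R) : 0 < t -> 0 <= g t. Proof. by case: fg => _ _ _ _; apply. Qed.

(** For a solution, [Y (phi - a) = phi' ^ 2] as a function of the value
    [x = phi - a]; since [dY/dx = 2 phi''], the second-order problem becomes a
    first-order equation whose solution exists for all [x >= 0]. *)
Lemma energy_exists : exists Y : R -> R,
  [/\ Y 0 = 0, continuous Y, forall x : R, 0 < x -> 0 < Y x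
    & forall x : R, 0 <= x ->
        is_derive x 1 Y (2 * f (a + x) + 2 * g (a + x) * Y x `^ (q / 2))].
Proof.
have shift_cont (h : R -> R) : continuous h -> continuous (fun x => 2 * h (a + x)).
  move=> ch x; apply: cvgM; first exact: cvg_cst.
  apply: (@continuous_comp _ _ _ (fun y : R => a + y) h); last exact: ch.
  by apply: cvgD; [exact: cvg_cst|exact: cvg_id].
have shift_nd (h : R -> R) : {homo h : s t / s <= t} ->
    {homo (fun x => 2 * h (a + x)) : s t / s <= t}.
  by move=> ndh s t st; rewrite ler_pM2l// ndh// lerD2l.
have ax (x : R) : 0 <= x -> 0 < a + x by move=> x0; rewrite ltr_pwDl.
have [||||Y [Y0 cY Yge0 dY]] := @sublinear_ode_exists R _ _ (q / 2)
  (shift_cont _ cf) (shift_cont _ cg) (shift_nd _ ndf) (shift_nd _ ndg).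
- by move=> x /ax/f0/ltW fx; rewrite mulr_ge0.
- by move=> x /ax/g0 gx; rewrite mulr_ge0.
- by rewrite divr_gt0.
- by rewrite ltr_pdivrMr// mul1r.
exists Y; split=> // x x0; rewrite -Y0.
apply: (is_derive_incr x0) => [y /andP[/ltW y0 _]|y /andP[/ltW y0 _]|].
- exact: dY.
- rewrite ltr_pwDl ?mulr_gt0 ?f0 ?ax//.
  by rewrite mulr_ge0 ?powR_ge0// mulr_ge0// g0// ax.
- exact: continuous_subspaceT.
Qed.

(** From the energy back to the solution: [dr = dx / sqrt Y]. The substitution
    [x = s ^ 2] removes the singularity at [x = 0], where [Y] vanishes to first
    order: the integrand becomes [2 / m s] with [m s = sqrt (Y (s ^ 2)) / s]
    continuous and positive, so the radius [rho] is a [C^1] function of [s] on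
    the whole line and inverts to [sigma], with [phi = a + sigma ^ 2]. Letting
    [s] grow, [phi] passes any prescribed level [M]. *)
Lemma ivp_exists (M : R) : exists (r0 : R) (phi phi1 : R -> R),
  [/\ 0 < r0, M < phi r0, phi 0 = a /\ phi1 0 = 0,
      forall r, 0 <= r <= r0 -> is_derive r 1 phi (phi1 r) /\
        is_derive r 1 phi1 (f (phi r) + g (phi r) * `|phi1 r| `^ q)
    & forall r, 0 < r <= r0 -> 0 < phi1 r].
Proof.
have [Y [Y0 cY Ygt0 dY]] := energy_exists.
(* the difference quotient of the energy at 0 *)
pose G (z : R) : R := if z == 0 then 2 * f a else Y z / z.
have Ggt0 (z : R) : 0 <= z -> 0 < G z.
  move=> z0; rewrite /G; case: eqVneq => [_|zn0]; first by rewrite mulr_gt0// f0.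
  by rewrite divr_gt0// ?Ygt0// lt0r zn0.
have YG z : Y z = G z * z.
  by rewrite /G; case: eqVneq => [->|zn0]; rewrite ?mulr0// divfK.
have cG : continuous G.
  move=> z; have [->|zn0] := eqVneq z 0.
    have := dY 0 (lexx 0); rewrite Y0 powR0 ?mulr0 ?addr0; last first.
      by rewrite mulf_neq0// ?invr_eq0 gt_eqF.
    move=> /is_derive1_caratheodory[G' [G'E cG' G'0]].
    rewrite (_ : G = G')//; apply/funext => z'.
    rewrite /G; case: eqVneq => [->//|z'0].
    by rewrite -[Y z'](subr0) -Y0 G'E subr0 mulfK.
  have zG : \forall y \near z, y != 0.
    by apply: open_nbhs_nbhs; split => //; exact: open_neq.
  have H : Y x * x^-1 @[x --> z] --> Y z * z^-1.
    by apply: cvgM; [exact: cY|apply: cvgV => //; exact: cvg_id].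
  rewrite /continuous_at {2}/G (negbTE zn0).
  apply: cvg_trans H; apply: near_eq_cvg; apply: filterS zG => y y0.
  by rewrite /G (negbTE y0).
pose m (s : R) : R := Num.sqrt (G (s ^+ 2)).
have m_gt0 s : 0 < m s by rewrite sqrtr_gt0 Ggt0// sqr_ge0.
have cm : continuous m.
  move=> s; apply: (@continuous_comp _ _ _ (fun s : R => G (s ^+ 2))); last exact: sqrt_continuous.
  by apply: (@continuous_comp _ _ _ (fun s : R => s ^+ 2)); [exact: exprn_continuous|exact: cG].
pose h (s : R) : R := 2 / m s.
have h_gt0 s : 0 < h s by rewrite divr_gt0.
have ch : continuous h.
  move=> s; apply: cvgM; first exact: cvg_cst.
  by apply: cvgV; [rewrite gt_eqF|exact: cm].
pose rho : R -> R := primitive h.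
have rho0 : rho 0 = 0 by exact: primitive0.
have drho (s : R) : is_derive s 1 rho (h s) by exact: is_derive_primitive.
have crho : continuous rho by exact: continuous_primitive.
have rho_incr (s t : R) : s < t -> rho s < rho t.
  by move=> st; apply: (is_derive_incr st (df := h)) => //; exact: continuous_subspaceT.
have rho_inj : injective rho.
  by move=> s t E; case: (ltgtP s t) => // /rho_incr; rewrite E ltxx.
pose sigma (r : R) : R := xget 0 [set s | rho s = r].
have rhoK : cancel rho sigma.
  by move=> s; apply: xget_unique => // t E; apply: rho_inj.
have dsigma (s : R) : is_derive (rho s) 1 sigma (h s)^-1.
  apply: (@is_derive_inverse R rho sigma (h s) s).
  - by near=> t; exact: rhoK.
  - by near=> t; exact: crho.
  - by rewrite gt_eqF.
(* phi' = s m(s); its derivative at s = 0, where the square root cannot be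
   differentiated, only needs the continuity of m *)
have dsm (s : R) : 0 <= s ->
    is_derive s 1 (fun s => s * m s)
      ((2 * f (a + s ^+ 2) + 2 * g (a + s ^+ 2) * (`|s * m s| `^ q)) / m s).
  rewrite le_eqVlt => /predU1P[<-|s0].
    apply/is_derive1_caratheodory; exists m; split.
    - by move=> z; rewrite mul0r !subr0 mulrC.
    - exact: cm.
    - rewrite mul0r normr0 powR0 ?gt_eqF// mulr0 addr0 expr0n /= addr0.
      rewrite /m expr0n /= /G eqxx.
      have fa0 : 0 < 2 * f a by rewrite mulr_gt0// f0.
      rewrite -{2}[2 * f a]sqr_sqrtr ?(ltW fa0)// expr2 mulfK//.
      by rewrite gt_eqF// sqrtr_gt0.
  have s20 : 0 < s ^+ 2 by rewrite exprn_gt0.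
  have smE (t : R) : 0 < t -> t * m t = Num.sqrt (Y (t ^+ 2)).
    move=> t0; rewrite YG sqrtrM ?(ltW (Ggt0 _ _)) ?sqr_ge0//.
    by rewrite sqrtr_sqr gtr0_norm// mulrC.
  have d2 : is_derive s 1 (fun t : R => t ^+ 2) (2 * s * 1).
    by apply: (@is_derive_sqr R id); exact: is_derive_id.
  have dYs := @is_derive1_comp R Y (fun t => t ^+ 2) s _ _ (dY _ (ltW s20)) d2.
  have dq := @is_derive1_comp R Num.sqrt _ s _ _ (is_derive1_sqrt (Ygt0 _ s20)) dYs.
  have sE : \forall t \near s, Num.sqrt (Y (t ^+ 2)) = t * m t.
    have : \forall t \near s, 0 < t by exact: lt_nbhsr.
    by apply: filterS => t t0; rewrite smE.
  apply: is_derive_eq; first exact: (near_eq_is_derive sE dq).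
  have -> : `|s * m s| `^ q = Y (s ^+ 2) `^ (q / 2).
    rewrite gtr0_norm ?mulr_gt0// smE// -powR12_sqrt ?(ltW (Ygt0 _ _))//.
    by rewrite -powRrM mulrC.
  rewrite /= -smE//.
  have mn : m s != 0 by rewrite gt_eqF.
  have sn : s != 0 by rewrite gt_eqF.
  by field; rewrite mn sn.
pose S := Num.max 1 M.
have S1 : 1 <= S by rewrite le_max lexx.
have S0 : 0 < S by exact: lt_le_trans S1.
pose phi (r : R) : R := a + sigma r ^+ 2.
pose phi1 (r : R) : R := sigma r * m (sigma r).
have rng (r : R) : 0 <= r <= rho S -> exists2 s, 0 <= s & r = rho s.
  move=> /andP[r_0 rS].
  have [|s] := @IVT R rho 0 S r (ltW S0) (continuous_subspaceT crho).
    have rS0 := ltW (rho_incr _ _ S0).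
    by rewrite rho0 in rS0 *; rewrite (min_idPl rS0) (max_idPr rS0) r_0.
  by rewrite in_itv /= => /andP[s0 _] <-; exists s.
exists (rho S), phi, phi1; split.
- by rewrite -rho0 rho_incr.
- rewrite /phi rhoK; apply: (@le_lt_trans _ _ S); first by rewrite le_max lexx orbT.
  by rewrite ltr_pwDl// expr2 ler_peMr// ltW.
- have sigma0 : sigma 0 = 0 by rewrite -[in LHS]rho0 rhoK.
  by rewrite /phi /phi1 sigma0 expr0n /= addr0 mul0r.
- move=> _ /rng[s s0 ->]; split.
  + have H := is_derive_add_cst a (is_derive_sqr (dsigma s)).
    apply: is_derive_eq.
    rewrite /phi1 rhoK /h.
    have mn : m s != 0 by rewrite gt_eqF.
    by field; rewrite mn.
  + have dsm' : is_derive (sigma (rho s)) 1 (fun s => s * m s)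
        ((2 * f (a + s ^+ 2) + 2 * g (a + s ^+ 2) * (`|s * m s| `^ q)) / m s).
      by rewrite rhoK; exact: dsm.
    have H := @is_derive1_comp R (fun s => s * m s) sigma (rho s) _ _ dsm' (dsigma s).
    apply: is_derive_eq.
    rewrite /phi /phi1 rhoK /h.
    have mn : m s != 0 by rewrite gt_eqF.
    by field; rewrite mn.
- move=> r /andP[r_gt0 rS].
  have [|s s0 rE] := rng r; first by rewrite (ltW r_gt0).
  rewrite /phi1 rE rhoK mulr_gt0// lt0r s0 andbT.
  by apply: contraTneq r_gt0 => sE; rewrite rE sE rho0 ltxx.
Unshelve. all: by end_near. Qed.

End existence.

(** * The blow-up radius *)

Lemma primitive_itvE (R : realType) (h : R -> R) (c b : R) :
  continuous h -> c <= b ->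
  primitive h b - primitive h c = \int[lebesgue_measure]_(s in `[c, b]) h s.
Proof.
move=> ch cb.
pose N := Num.min 0 c.
have N0 : N <= 0 by rewrite ge_min lexx.
have Nc : N <= c by rewrite ge_min lexx orbT.
rewrite (primitive_split ch N0 Nc) (primitive_split ch N0 (le_trans Nc cb)).
rewrite opprB addrA subrK.
have := @Rintegral_itvB R h (BLeft N) (BRight b) c
  (continuous_itv_integrable N b ch).
rewrite !bnd_simp => /(_ Nc cb) ->.
apply: Rintegral_itv_obnd_cbnd.
apply: (integrableS _ _ _ (continuous_itv_integrable c b ch)) => //.
exact: subset_itv_oc_cc.
Qed.

(** Replacing the argument by its maximum with [c] makes [k] continuous on the
    whole line without changing its integral over [[c, b]]. *)
Lemma itv_le_halfline (R : realType) (k : R -> R) (a c b : R) :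
  a < c -> c <= b -> (forall s, a < s -> 0 <= k s) ->
  (forall s, a < s -> {for s, continuous k}) ->
  ((primitive (fun s => k (Num.max s c)) b - primitive (fun s => k (Num.max s c)) c)%:E
   <= \int[lebesgue_measure]_(s in `]a, +oo[) (k s)%:E)%E.
Proof.
move=> ac cb k0 ck.
pose kc s := k (Num.max s c).
have ckc : continuous kc.
  move=> s; apply: (@continuous_comp _ _ _ (fun s => Num.max s c) k).
    by apply: (@continuous_max _ _ id (cst c)); [exact: cvg_id|exact: cvg_cst].
  by apply: ck; rewrite lt_max ac orbT.
rewrite (primitive_itvE ckc cb) /Rintegral fineK; last first.
  by apply: integrable_fin_num => //; exact: continuous_itv_integrable.
rewrite (_ : (\int[lebesgue_measure]_(x in `[c, b]) (kc x)%:E)%E =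
    (\int[lebesgue_measure]_(x in `[c, b]) (k x)%:E)%E); last first.
  apply: eq_integral => x; rewrite inE /= in_itv /= => /andP[cx _].
  by rewrite /kc (max_idPl cx).
apply: ge0_subset_integral => //.
- apply/measurable_EFinP; apply: open_continuous_measurable_fun => //.
  by move=> x; rewrite inE /= in_itv /= andbT; exact: ck.
- by move=> x /=; rewrite in_itv /= andbT lee_fin => /k0.
- move=> x /=; rewrite !in_itv /= andbT => /andP[cx _].
  exact: lt_le_trans cx.
Qed.

Lemma is_derive_has_derivative_within (R : realType) (A : set R) (h : R -> R)
    (x l : R) : is_derive x 1 h l -> has_derivative_within A h x l.
Proof.
move=> /is_derive1_caratheodory[G [hE cG Gx]].
rewrite /has_derivative_within -Gx.
have cG' : G y @[y --> within A x^'] --> G x.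
  apply: cvg_trans cG; apply: cvg_app.
  apply: cvg_trans (@cvg_within _ _ _ _) _.
  exact: nbhs_dnbhs.
apply: cvg_trans cG'; apply: near_eq_cvg.
apply: cvg_within; near=> y.
rewrite hE mulfK// subr_eq0.
by near: y; exact: nbhs_dnbhs_neq.
Unshelve. all: by end_near. Qed.

(** A solution presented by two-sided derivatives on the closed interval
    [[0, r0]], as [ivp_exists] provides it. *)
Section radius.
Context (R : realType) (f g : R -> R) (q a : R).
Hypotheses (q0 : 0 < q) (q2 : q < 2) (fg : nondecreasing_cont_sign f g).
Hypothesis (a0 : 0 < a).
Context (r0 : R) (phi phi1 : R -> R).
Hypothesis r0_gt0 : 0 < r0.
Hypotheses (phi_0 : phi 0 = a) (phi1_0 : phi1 0 = 0).
Hypothesis dphi : forall r, 0 <= r <= r0 -> is_derive r 1 phi (phi1 r).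
Hypothesis dphi1 : forall r, 0 <= r <= r0 ->
  is_derive r 1 phi1 (f (phi r) + g (phi r) * `|phi1 r| `^ q).
Hypothesis phi1_gt0 : forall r, 0 < r <= r0 -> 0 < phi1 r.

Let cf : continuous f. Proof. by case: fg => _ []. Qed.
Let cg : continuous g. Proof. by case: fg => _ []. Qed.

Lemma ivp_solution_of_derive : ivp_solution f g q a r0 phi phi1
  (fun r => f (phi r) + g (phi r) * `|phi1 r| `^ q).
Proof.
have W (r : R) : 0 <= r < r0 -> 0 <= r <= r0.
  by move=> /andP[-> /ltW ->].
split => //.
- by move=> r /W rr; apply: is_derive_has_derivative_within; exact: dphi.
- by move=> r /W rr; apply: is_derive_has_derivative_within; exact: dphi1.
- apply: continuous_in_subspaceT => r /set_mem /=; rewrite in_itv /= => /W rr.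
  have cp := is_derive_continuous (dphi rr).
  have cp1 := is_derive_continuous (dphi1 rr).
  apply: cvgD; first exact: (continuous_cvg _ (@cf _) cp).
  apply: cvgM; first exact: (continuous_cvg _ (@cg _) cp).
  exact: (continuous_cvg _ (@continuous_norm_powR R q q0 _) cp1).
Qed.

Lemma ivp_incr (r s : R) : 0 <= r -> r < s -> s <= r0 -> phi r < phi s.
Proof.
move=> r_0 rs sr0.
have W (x : R) : r <= x <= s -> 0 <= x <= r0.
  by move=> /andP[rx xs]; rewrite (le_trans r_0 rx) (le_trans xs sr0).
apply: (is_derive_incr rs (df := phi1)) => [x /andP[rx xs]|x /andP[rx xs]|].
- by apply: dphi; apply: W; rewrite !ltW.
- by apply: phi1_gt0; rewrite (le_lt_trans r_0 rx) (le_trans (ltW xs) sr0).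
- apply: (is_derive_within_continuous (df := phi1)) => x /=; rewrite in_itv /=.
  by move=> xrs; apply: dphi; exact: W.
Qed.

(** Along [phi] the function [\int k] grows at least at unit speed, so the time
    [r0] spent is at most the whole integral of [k]. The integral is taken from
    [phi r1] with [r1 > 0], because [k] may be singular at [a]. *)
Lemma radius_le_integral (k : R -> R) :
  (forall s, a < s -> 0 < k s) ->
  (forall s, a < s -> {for s, continuous k}) ->
  (forall r, 0 < r < r0 -> 1 <= k (phi r) * phi1 r) ->
  (r0%:E <= \int[lebesgue_measure]_(s in `]a, +oo[) (k s)%:E)%E.
Proof.
move=> k0 ck kphi.
set I := (X in (_ <= X)%E).
have I0 : (0 <= I)%E.
  by apply: integral_ge0 => s /=; rewrite in_itv /= andbT => /k0/ltW; rewrite lee_fin.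
have main (r1 r2 : R) : 0 < r1 -> r1 < r2 -> r2 < r0 -> ((r2 - r1)%:E <= I)%E.
  move=> r1_0 r12 r20.
  set c := phi r1; set b := phi r2.
  have ac : a < c by rewrite -phi_0; apply: ivp_incr => //; rewrite ltW// (lt_trans r12).
  have cb : c < b by apply: ivp_incr; rewrite // ltW.
  pose kc s := k (Num.max s c).
  have ckc : continuous kc.
    move=> s; apply: (@continuous_comp _ _ _ (fun s => Num.max s c) k).
      by apply: (@continuous_max _ _ id (cst c)); [exact: cvg_id|exact: cvg_cst].
    by apply: ck; rewrite lt_max ac orbT.
  pose E r := primitive kc (phi r) - r.
  have W (r : R) : r1 <= r <= r2 -> 0 <= r <= r0.
    by move=> /andP[rx xs]; rewrite (le_trans (ltW r1_0) rx) (le_trans xs (ltW r20)).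
  pose dE r := kc (phi r) * phi1 r - 1.
  have dEE (r : R) : r1 <= r <= r2 -> is_derive r 1 E (dE r).
    move=> /W rr; apply: is_deriveB.
    apply: (@is_derive1_comp R (primitive kc)); last exact: dphi.
    exact: is_derive_primitive.
  have EE : E r1 <= E r2.
    apply: (is_derive_ndecr (ltW r12) (df := dE)) => [r /andP[/ltW rx /ltW xs]|r /andP[rx xs]|].
    - by apply: dEE; rewrite rx.
    - have cr : c < phi r.
        by apply: ivp_incr => //; rewrite ltW// (lt_trans xs).
      rewrite /dE /kc (max_idPl (ltW cr)) subr_ge0.
      by apply: kphi; rewrite (lt_trans r1_0)// (lt_trans xs).
    - by apply: (is_derive_within_continuous (df := dE)) => r /=; rewrite in_itv.
  have : r2 - r1 <= primitive kc b - primitive kc c.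
    by move: EE; rewrite /E -/c -/b; lra.
  rewrite -lee_fin => /le_trans; apply.
  by apply: itv_le_halfline => // [|s /k0/ltW]; first exact: ltW.
move: I0 main; case: I => [i|_ _|//]; last by rewrite leey.
rewrite lee_fin => i0 main; rewrite lee_fin leNgt; apply/negP => ir.
(* trimming a third of the excess at both ends still leaves more than i *)
have := main ((r0 - i) / 3) (r0 - (r0 - i) / 3).
rewrite lee_fin => H; have : r0 - (r0 - i) / 3 - (r0 - i) / 3 <= i by apply: H; lra.
lra.
Qed.

End radius.

Lemma nondecreasing_cont_sign_scale (R : realType) (f g : R -> R) (l : R) :
  0 < l -> nondecreasing_cont_sign f g ->
  nondecreasing_cont_sign (fun t => l * f t) g.
Proof.
move=> l0 [[ndf ndg] [cf cg] fs st g0]; split => //.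
- by split=> // s t /ndf fst; rewrite ler_pM2l.
- by split=> // t; apply: cvgM; [exact: cvg_cst|exact: cf].
- move=> t /fs[f1 f2]; rewrite pmulr_rlt0// pmulr_rgt0//.
- by case: st => st; [left => s t /st; rewrite ltr_pM2l|right].
Qed.

Lemma primitive_scale (R : realType) (f : R -> R) (l t : R) : continuous f ->
  primitive (fun s => l * f s) t = l * primitive f t.
Proof.
move=> cf; rewrite /primitive.
case: ifP => _; rewrite RintegralZl ?mulrN//; exact: continuous_itv_integrable.
Qed.

(** Shrinking [f] by [l] costs a factor [sqrt l] at most in the denominator. *)
Lemma KO_denom_scale (R : realType) (q l x y : R) : 0 <= l <= 1 ->
  Num.sqrt l * KO_denom q x y <= KO_denom q (l * x) y.
Proof.
move=> /andP[l0 l1]; rewrite /KO_denom mulrDr sqrtrM// lerD2l.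
by rewrite ler_piMl ?powR_ge0// -sqrtr1 ler_wsqrtr.
Qed.

(** * Integrals on half-lines *)

Lemma measurable_shift (R : realType) (t : R) :
  measurable_fun [set: measurableTypeR R]
    ((fun x => t + x) : measurableTypeR R -> measurableTypeR R).
Proof.
apply: continuous_measurable_fun => x.
by apply: (@cvgD _ R); [exact: cvg_cst|exact: cvg_id].
Qed.

Lemma lebesgue_measure_shift (R : realType) (t : R) (A : set R) : measurable A ->
  pushforward lebesgue_measure
    ((fun x => t + x) : measurableTypeR R -> measurableTypeR R) A
  = lebesgue_measure A.
Proof.
have msh := @measurable_shift R t.
move=> mA; apply/esym/lebesgue_measure_unique => //= _ [[a b]] _ <-.
rewrite /pushforward.
rewrite (_ : _ @^-1` _ = `]a - t, b - t]%classic); last first.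
  apply/seteqP; split => x /=; rewrite !in_itv /= => /andP[ax xb];
    apply/andP; split; lra.
rewrite !lebesgue_measure_itv/= !lte_fin ltrD2r; case: ifP => // _.
by rewrite -!EFinB; congr EFin; lra.
Qed.

Lemma ge0_integral_shift (R : realType) (t : R) (h : R -> \bar R) :
  measurable_fun `]t, +oo[ h -> (forall s, t < s -> (0 <= h s)%E) ->
  (\int[lebesgue_measure]_(s in `]t, +oo[) h s
   = \int[lebesgue_measure]_(s in `]0%R, +oo[) h (t + s)%R)%E.
Proof.
move=> mh h0.
pose sh := (fun x => t + x) : measurableTypeR R -> measurableTypeR R.
have msh : measurable_fun setT sh by exact: measurable_shift.
have -> : `]0%R, +oo[%classic = sh @^-1` `]t, +oo[%classic.
  by apply/seteqP; split => x /=; rewrite !in_itv /= !andbT ltrDl.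
transitivity (\int[pushforward lebesgue_measure sh]_(s in `]t, +oo[) h s)%E.
  by apply: eq_measure_integral => //= A mA _; exact/esym/lebesgue_measure_shift.
rewrite ge0_integral_pushforward//.
by move=> x; rewrite inE /= in_itv /= andbT; exact: h0.
Qed.

Lemma halfline_integral_gt0 (R : realType) (k : R -> R) (a : R) :
  (forall s, a < s -> 0 < k s) -> (forall s, a < s -> {for s, continuous k}) ->
  (0 < \int[lebesgue_measure]_(s in `]a, +oo[) (k s)%:E)%E.
Proof.
move=> k0 ck.
have a1 : a < a + 1 by rewrite ltrDl.
have a12 : a + 1 < a + 1 + 1 by rewrite ltrDl.
apply: lt_le_trans (itv_le_halfline a1 (ltW a12) (fun s as_ => ltW (k0 s as_)) ck).
set kc := fun s => _.
have kc0 s : 0 < kc s by apply: k0; rewrite lt_max a1 orbT.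
have ckc : continuous kc.
  move=> s; apply: (@continuous_comp _ _ _ (fun s => Num.max s (a + 1)) k).
    by apply: (@continuous_max _ _ id (cst (a + 1))); [exact: cvg_id|exact: cvg_cst].
  by apply: ck; rewrite lt_max a1 orbT.
rewrite lte_fin subr_gt0; apply: (is_derive_incr a12 (df := kc)) => // [x _|].
  exact: is_derive_primitive.
by apply: continuous_subspaceT; exact: continuous_primitive.
Qed.

(** The inverse square root is bounded below by its translates
    [1 / sqrt (s + 1 / (n + 1))], whose integrals over [0, 1] stay below [4];
    monotone convergence does the rest. *)
Lemma inv_sqrt_integrable (R : realType) :
  (\int[lebesgue_measure]_(s in `]0%R, 1%R]) ((Num.sqrt (s : R))^-1)%:E < +oo)%E.
Proof.
pose e n : R := n.+1%:R^-1.
have e0 n : 0 < e n by rewrite invr_gt0.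
have e1 n : e n <= 1 by rewrite invf_le1// ler1n.
pose k n (s : R) : R := (Num.sqrt (`|s| + e n))^-1.
have arg_gt0 n (s : R) : 0 < `|s| + e n by rewrite ltr_wpDl.
have ck n : continuous (k n).
  move=> s; apply: cvgV; first by rewrite gt_eqF// sqrtr_gt0.
  apply: (@continuous_comp _ _ _ (fun s : R => `|s| + e n)); last exact: sqrt_continuous.
  by apply: cvgD; [exact: norm_continuous|exact: cvg_cst].
have bound n : (\int[lebesgue_measure]_(s in `]0%R, 1%R]) (k n s)%:E <= 4%:E)%E.
  apply: (@le_trans _ _ (\int[lebesgue_measure]_(s in `[0%R, 1%R]) (k n s)%:E)%E).
    apply: ge0_subset_integral => //.
    - exact: continuous_EFin_measurable.
    - by move=> s _; rewrite lee_fin invr_ge0 sqrtr_ge0.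
    - exact: subset_itv_oc_cc.
  have := @primitive_itvE R (k n) 0 1 (ck n) ler01.
  rewrite primitive0 subr0 /Rintegral => E.
  rewrite -[leLHS]fineK; last first.
    by apply: integrable_fin_num => //; exact: continuous_itv_integrable.
  rewrite -E lee_fin.
  pose D s := 2 * Num.sqrt (s + e n) - primitive (k n) s.
  have dD (s : R) : 0 <= s -> is_derive s 1 D 0.
    move=> s0.
    have se : 0 < s + e n by rewrite ltr_wpDl.
    have d1 : is_derive s 1 (fun s => s + e n) 1.
      have := is_derive_add_cst (e n) (@is_derive_id R R s 1).
      by under eq_fun do rewrite addrC.
    have d2 := @is_derive1_comp R Num.sqrt _ s _ _ (is_derive1_sqrt se) d1.
    have d3 := @is_deriveZ R _ _ _ 2 s 1 _ d2.
    have d4 := is_deriveB d3 (is_derive_primitive s (ck n)).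
    apply: is_derive_eq.
    rewrite /k ger0_norm//.
    have sn : Num.sqrt (s + e n) != 0 by rewrite gt_eqF// sqrtr_gt0.
    by rewrite /GRing.scale /=; field; rewrite sn.
  have D01 : D 0 <= D 1.
    apply: (@is_derive_ndecr R D (cst 0)) => // [s /andP[/ltW s0 _]|].
      exact: dD.
    apply: (is_derive_within_continuous (df := cst 0)) => s /=.
    by rewrite in_itv /= => /andP[s0 _]; exact: dD.
  have s2 : Num.sqrt (1 + e n) <= 2.
    rewrite -[leRHS](@ger0_norm R)// -sqrtr_sqr ler_wsqrtr//.
    by have := e1 n; rewrite expr2; lra.
  have : 0 <= D 0 by rewrite /D primitive0 subr0 mulr_ge0// sqrtr_ge0.
  by rewrite /D in D01 *; move: D01 s2; lra.
have lim_k (s : R) : 0 < s -> (k n s)%:E @[n --> \oo] --> ((Num.sqrt s)^-1)%:E.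
  move=> s0; apply/fine_cvgP; split; first exact: nearW.
  apply: cvgV; first by rewrite gt_eqF// sqrtr_gt0.
  apply: (continuous_cvg _ (@sqrt_continuous R s)).
  rewrite -[X in _ --> X]addr0; apply: cvgD; last exact: cvg_harmonic.
  by rewrite gtr0_norm//; exact: cvg_cst.
apply: (@le_lt_trans _ _ 4%:E); last by rewrite ltry.
rewrite (_ : \int[_]_(_ in _) _ =
  \int[lebesgue_measure]_(s in `]0%R, 1%R]) limn (fun n => (k n s)%:E))%E; last first.
  apply: eq_integral => s; rewrite inE /= in_itv /= => /andP[s0 _].
  by apply/esym/cvg_lim => //; exact: lim_k.
have mk n : measurable_fun (`]0%R, 1%R] : set R) (fun s => (k n s)%:E).
  by apply: continuous_EFin_measurable; exact: ck.
have H := @cvg_monotone_convergence _ _ R lebesgue_measure `]0%R, 1%R]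
  (measurable_itv _) (fun n s => (k n s)%:E) mk.
apply: (@cvge_le _ _ _ _ _ _ _ _ (H _ _)).
- by apply: nearW => n; exact: bound.
- by move=> n s _; rewrite lee_fin invr_ge0 sqrtr_ge0.
- move=> s /=; rewrite in_itv /= => /andP[s0 _] m n mn.
  rewrite lee_fin lef_pV2 ?posrE ?sqrtr_gt0// ler_wsqrtr// lerD2l.
  by rewrite lef_pV2 ?posrE// ler_nat.
Qed.

(** * The function [Psi] *)

Section psi.
Context (R : realType) (f g : R -> R) (q : R).
Hypotheses (q2 : q < 2) (fg : nondecreasing_cont_sign f g).

Let ndf : {homo f : s t / s <= t}. Proof. by case: fg => -[]. Qed.
Let ndg : {homo g : s t / s <= t}. Proof. by case: fg => -[]. Qed.
Let cf : continuous f. Proof. by case: fg => _ []. Qed.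
Let cg : continuous g. Proof. by case: fg => _ []. Qed.
Let f0 (t : R) : 0 < t -> 0 < f t. Proof. by case: fg => _ _ + _ _ => /[apply] -[]. Qed.

(** The integrand of [Psi] in the variable [s - t], which moves the dependence
    on [t] from the domain of integration to the integrand; [psi] is [C] times
    [Psi], as a real number. *)
Definition psi_kernel (t s : R) : R :=
  (KO_denom q (primitive f (t + s) - primitive f t)
              (primitive g (t + s) - primitive g t))^-1.

Definition psi (t : R) : R :=
  \int[lebesgue_measure]_(s in `]0, +oo[) psi_kernel t s.

Lemma psi_kernel_gt0 (t s : R) : 0 <= t -> 0 < s -> 0 < psi_kernel t s.
Proof.
move=> t0 s0; rewrite invr_gt0.
by apply: KO_denom_increment_gt0; rewrite ?ltrDl.
Qed.

Lemma psi_kernel_nincr (t t' s : R) : 0 <= t -> t <= t' -> 0 < s ->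
  psi_kernel t' s <= psi_kernel t s.
Proof.
move=> t0 tt' s0; have t'0 := le_trans t0 tt'.
rewrite lef_pV2 ?posrE; last 2 first.
- by rewrite -invr_gt0 psi_kernel_gt0.
- by rewrite -invr_gt0 psi_kernel_gt0.
apply: le_KO_denom => //.
- by apply: increment_ndecr => //; exact: ltW.
- by apply: (increment_g_ge0 fg) => //; exact: ltW.
- by apply: increment_ndecr => //; exact: ltW.
Qed.

Lemma psi_kernel_decr (t t' s : R) : 0 <= t -> t < t' -> 0 < s ->
  psi_kernel t' s < psi_kernel t s.
Proof.
move=> t0 tt' s0; have t'0 := ltW (le_lt_trans t0 tt').
rewrite ltf_pV2 ?posrE; last 2 first.
- by rewrite -invr_gt0 psi_kernel_gt0.
- by rewrite -invr_gt0 psi_kernel_gt0.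
have fle : primitive f (t + s) - primitive f t <= primitive f (t' + s) - primitive f t'.
  by apply: increment_ndecr => //; exact: ltW.
have gle : primitive g (t + s) - primitive g t <= primitive g (t' + s) - primitive g t'.
  by apply: increment_ndecr => //; exact: ltW.
have g_ge0 := increment_g_ge0 fg t0 (ltW s0).
have p_gt0 := KO_exponent_gt0 q2.
have [_ _ _ [sf|sg] _] := fg.
- have flt := increment_incr cf sf tt' s0.
  apply: ltr_leD.
    rewrite ltr_sqrt// subr_gt0.
    by apply: (primitive_f_incr fg); rewrite ?ltrDl.
  by rewrite ge0_ler_powR ?nnegrE ?(ltW p_gt0)// (le_trans g_ge0).
- have glt := increment_incr cg sg tt' s0.
  apply: ler_ltD; first exact: ler_wsqrtr.
  by rewrite gt0_ltr_powR ?nnegrE// (le_trans g_ge0).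
Qed.

Lemma psi_kernel_cvg T (F : set_system T) (FF : Filter F) (tt ss : T -> R) (t s : R) :
  (\forall x \near F, 0 <= tt x) -> (\forall x \near F, 0 <= ss x) ->
  0 <= t -> 0 < s -> tt @ F --> t -> ss @ F --> s ->
  psi_kernel (tt x) (ss x) @[x --> F] --> psi_kernel t s.
Proof.
move=> tt0 ss0 t0 s0 tl sl.
have inc (h : R -> R) : continuous h ->
    (primitive h (tt x + ss x) - primitive h (tt x)) @[x --> F]
    --> primitive h (t + s) - primitive h t.
  move=> ch; have cp := continuous_primitive ch.
  have sum : (tt x + ss x) @[x --> F] --> t + s by exact: cvgD.
  by apply: cvgB; [exact: (continuous_cvg FF (cp _) sum)|exact: (continuous_cvg FF (cp _) tl)].
apply: cvgV; first by rewrite gt_eqF// -invr_gt0 psi_kernel_gt0.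
apply: KO_denom_cvg => //.
- by apply: filterS2 tt0 ss0 => x tx sx; exact: (increment_g_ge0 fg).
- by apply: (increment_g_ge0 fg) => //; exact: ltW.
- exact: inc.
- exact: inc.
Qed.

Lemma psi_kernel_continuous (t s : R) : 0 <= t -> 0 < s ->
  {for s, continuous (psi_kernel t)}.
Proof.
move=> t0 s0; apply: psi_kernel_cvg => //.
- exact: nearW.
- have : \forall x \near s, 0 < x by exact: lt_nbhsr.
  by apply: filterS => x /ltW.
- exact: cvg_cst.
Qed.

Lemma inv_KO_increment_continuous (t s : R) : 0 <= t -> t < s ->
  {for s, continuous (fun s => (KO_denom q (primitive f s - primitive f t)
                                  (primitive g s - primitive g t))^-1)}.
Proof.
move=> t0 ts; have st : 0 < s - t by rewrite subr_gt0.
have cK := psi_kernel_continuous t0 st.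
have cB : continuous (fun s : R => s - t).
  by move=> x; apply: cvgB; [exact: cvg_id|exact: cvg_cst].
have -> : (fun s => (KO_denom q (primitive f s - primitive f t)
    (primitive g s - primitive g t))^-1) = psi_kernel t \o (fun s : R => s - t).
  by apply/funext => x /=; rewrite /psi_kernel (addrC t) subrK.
exact: continuous_comp (@cB s) cK.
Qed.

Lemma psi_kernel_measurable (t : R) (A : set R) : 0 <= t ->
  A `<=` `]0, +oo[ -> measurable_fun A (EFin \o psi_kernel t).
Proof.
move=> t0 A0.
have m0 : measurable_fun (`]0, +oo[ : set R) (EFin \o psi_kernel t).
  apply/measurable_EFinP; apply: open_continuous_measurable_fun => //.
  by move=> s; rewrite inE /= in_itv /= andbT => s0; exact: psi_kernel_continuous.
exact: measurable_funS A0 m0.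
Qed.

Hypothesis KO : keller_osserman f g q.

(** Near [0] the kernel is at most [1 / sqrt (f t * s)]; beyond [1], moving the
    base point [t] down to [0] bounds it by the Keller-Osserman integrand. *)
Lemma psi_kernel_integrable (t : R) : 0 < t ->
  (@lebesgue_measure R).-integrable `]0, +oo[ (EFin \o psi_kernel t).
Proof.
move=> t0; have t0' := ltW t0.
have sub01 : (`]0, 1] `<=` (`]0, +oo[ : set R)).
  by move=> s /=; rewrite !in_itv /= andbT => /andP[].
have sub1y : (`]1, +oo[ `<=` (`]0, +oo[ : set R)).
  by move=> s /=; rewrite !in_itv /= !andbT; exact: lt_trans.
have K0 (s : R) : 0 < s -> (0 <= (psi_kernel t s)%:E)%E.
  by move=> s0; rewrite lee_fin ltW// psi_kernel_gt0.
have msqrt : measurable_fun (`]0%R, 1%R] : set R)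
    (fun s : R => ((Num.sqrt s)^-1)%:E).
  have m0 : measurable_fun (`]0%R, +oo[ : set R)
      (fun s : R => ((Num.sqrt s)^-1)%:E).
    apply/measurable_EFinP; apply: open_continuous_measurable_fun => // s.
    rewrite inE /= in_itv /= andbT => s0.
    by apply: cvgV; [rewrite gt_eqF// sqrtr_gt0|exact: sqrt_continuous].
  exact: measurable_funS sub01 m0.
apply/integrableP; split; first exact: psi_kernel_measurable.
rewrite (_ : (\int[_]_(_ in _) _)%E =
    (\int[lebesgue_measure]_(s in `]0%R, +oo[) (psi_kernel t s)%:E)%E); last first.
  apply: eq_integral => s; rewrite inE /= in_itv /= andbT => s0.
  by rewrite /= ger0_norm// ltW// psi_kernel_gt0.
have -> : `]0%R, +oo[%classic = (`]0%R, 1%R] : set R) `|` `]1%R, +oo[.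
  apply/seteqP; split => s /=; rewrite !in_itv /= !andbT.
    by move=> s0; case: (leP s 1) => s1; [left; rewrite s0|right].
  by case=> [/andP[]//|]; exact: lt_trans.
rewrite ge0_integral_setU//; last 3 first.
- by apply: psi_kernel_measurable => //; rewrite subUset; split.
- by move=> s /= [/sub01|/sub1y] /=; rewrite in_itv /= andbT; exact: K0.
- apply/disj_setPS => s /=; rewrite !in_itv /= andbT => -[/andP[_ s1]].
  by rewrite ltNge s1.
apply: lte_add_pinfty.
- apply: (@le_lt_trans _ _ (\int[lebesgue_measure]_(s in `]0%R, 1%R])
      ((Num.sqrt (f t))^-1%:E * ((Num.sqrt (s : R))^-1)%:E))%E).
    apply: ge0_le_integral => //.
    + by move=> s /sub01 /=; rewrite in_itv /= andbT; exact: K0.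
    + exact: psi_kernel_measurable.
    + by apply: measurable_funeM; exact: msqrt.
    + move=> s /=; rewrite in_itv /= => /andP[s0 _].
      rewrite -EFinM lee_fin -invfM -sqrtrM ?(ltW (f0 _))//.
      rewrite lef_pV2 ?posrE ?sqrtr_gt0 ?mulr_gt0 ?f0//; last first.
        by rewrite -invr_gt0 psi_kernel_gt0.
      apply: (@le_trans _ _ (Num.sqrt (primitive f (t + s) - primitive f t))).
        by rewrite ler_wsqrtr// increment_ge// ltW.
      by rewrite lerDl powR_ge0.
  rewrite ge0_integralZl ?lee_fin ?invr_ge0 ?sqrtr_ge0//.
  by rewrite lte_mul_pinfty ?inv_sqrt_integrable// lee_fin invr_ge0 sqrtr_ge0.
- have m1 : measurable_fun (`[1%R, +oo[ : set R)
      (fun s => ((KO_denom q (primitive f s) (primitive g s))^-1)%:E).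
    rewrite (_ : (fun s => _) = EFin \o psi_kernel 0); last first.
      by apply/funext => s /=; rewrite /psi_kernel add0r !primitive0 !subr0.
    apply: psi_kernel_measurable => // s /=; rewrite !in_itv /= !andbT.
    exact: lt_le_trans.
  apply: le_lt_trans KO.
  apply: (@le_trans _ _ (\int[lebesgue_measure]_(s in `]1%R, +oo[)
      ((KO_denom q (primitive f s) (primitive g s))^-1)%:E)%E); last first.
    apply: ge0_subset_integral => //.
    + move=> s _; rewrite lee_fin invr_ge0 addr_ge0 ?sqrtr_ge0 ?powR_ge0//.
    + by move=> s /=; rewrite !in_itv /= !andbT => /ltW.
  apply: ge0_le_integral => //.
  + by move=> s /sub1y /=; rewrite in_itv /= andbT; exact: K0.
  + exact: psi_kernel_measurable.
  + apply: (measurable_funS _ _ m1) => // s /=; rewrite !in_itv /= !andbT.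
    exact: ltW.
  + move=> s /=; rewrite in_itv /= andbT => s1; rewrite lee_fin.
    have := @psi_kernel_nincr 0 t s (lexx 0) t0' (lt_trans ltr01 s1).
    by rewrite {2}/psi_kernel add0r !primitive0 !subr0.
Qed.

Lemma PsiE (C t : R) : 0 < t -> Psi f g q C t = (C^-1 * psi t)%:E.
Proof.
move=> t0; rewrite /Psi EFinM; congr (_ * _)%E.
rewrite ge0_integral_shift; last 2 first.
- apply/measurable_EFinP; apply: open_continuous_measurable_fun => // s.
  rewrite inE /= in_itv /= andbT => ts.
  exact: inv_KO_increment_continuous (ltW t0) ts.
- by move=> s ts; rewrite lee_fin invr_ge0 addr_ge0 ?sqrtr_ge0 ?powR_ge0.
rewrite /psi /Rintegral fineK//.
by apply: integrable_fin_num => //; exact: psi_kernel_integrable.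
Qed.

Lemma psi_gt0 (t : R) : 0 < t -> 0 < psi t.
Proof.
move=> t0; rewrite -lte_fin /psi /Rintegral fineK; last first.
  by apply: integrable_fin_num => //; exact: psi_kernel_integrable.
apply: halfline_integral_gt0 => s s0; first exact: psi_kernel_gt0 (ltW t0) s0.
exact: psi_kernel_continuous (ltW t0) s0.
Qed.

Lemma psi_decr (t t' : R) : 0 < t -> t < t' -> psi t' < psi t.
Proof.
move=> t0 tt'; have t'0 := lt_trans t0 tt'.
have [iK iK'] := (psi_kernel_integrable t0, psi_kernel_integrable t'0).
pose k s := psi_kernel t s - psi_kernel t' s.
have iB : (@lebesgue_measure R).-integrable `]0, +oo[ (EFin \o k).
  exact: (integrableB _ iK iK').
have E : psi t - psi t' = \int[lebesgue_measure]_(s in `]0, +oo[) k s.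
  by rewrite /psi -(RintegralB _ iK iK').
rewrite -subr_gt0 E -lte_fin /Rintegral fineK; last exact: integrable_fin_num iB.
apply: halfline_integral_gt0 => s s0.
  by rewrite subr_gt0; exact: psi_kernel_decr (ltW t0) tt' s0.
by apply: cvgB; apply: psi_kernel_continuous => //; exact: ltW.
Qed.

(** Near [t] all kernels are dominated by the one at [t / 2]. *)
Lemma psi_continuous (t : R) : 0 < t -> {for t, continuous psi}.
Proof.
move=> t0.
have t20 : 0 < t / 2 by rewrite divr_gt0.
have pos (x : R) : `]t / 2, t + 1[%classic x -> 0 < x.
  by rewrite /= in_itv /= => /andP[/(lt_trans t20)].
apply: (@continuity_under_integral R _ _ lebesgue_measure psi_kernel
  `]0, +oo[ _ (t / 2) (t + 1) _ _ (psi_kernel (t / 2))) => //.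
- by move=> x /pos x0; exact: psi_kernel_integrable.
- apply: aeW => s /=; rewrite in_itv /= andbT => s0 x /set_mem /pos x0.
  apply: psi_kernel_cvg => //.
  + have : \forall y \near x, 0 < y by exact: lt_nbhsr.
    by apply: filterS => y /ltW.
  + by apply: nearW => _; exact: ltW.
  + exact: ltW.
  + exact: cvg_cst.
- exact: psi_kernel_integrable.
- move=> x xI; apply: aeW => s /=; rewrite in_itv /= andbT => s0.
  have x0 := ltW (pos _ xI).
  have K0 : 0 <= psi_kernel x s by exact: ltW (psi_kernel_gt0 x0 s0).
  rewrite (ger0_norm K0).
  apply: psi_kernel_nincr => //; first exact: ltW.
  by move: xI; rewrite /= in_itv /= => /andP[/ltW].
- by rewrite inE /= in_itv /=; apply/andP; split; lra.
Qed.

Lemma psi_kernel_le (t s e : R) : 0 < e ->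
  e^-1 <= KO_denom q (primitive f (t + s) - primitive f t)
                     (primitive g (t + s) - primitive g t) ->
  psi_kernel t s <= e.
Proof.
move=> e0 eK; have ei0 : 0 < e^-1 by rewrite invr_gt0.
by rewrite /psi_kernel invf_ple// posrE; exact: lt_le_trans eK.
Qed.

Definition unbounded_above (h : R -> R) := forall A : R, exists t, A <= h t.

(** As the base point goes to infinity the kernel tends to [0] pointwise, its
    denominator being at least [sqrt (f t * s)] and at least
    [(g t * s) ^ (1 / (2 - q))]; dominated convergence along [t = n + 1]. *)
Lemma psi_small : unbounded_above f \/ unbounded_above g ->
  forall d, 0 < d -> exists2 t, 0 < t & psi t < d.
Proof.
move=> growth d d0.
have small (s : R) : 0 < s -> psi_kernel n.+1%:R s @[n --> \oo] --> (0 : R).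
  move=> s0; apply/cvgrPdist_le => e e0.
  suff [T T0 HT] : exists2 T, 0 < T & forall t, T <= t -> psi_kernel t s <= e.
    near=> n.
    have n0 : 0 <= n.+1%:R :> R by [].
    have K0 : 0 <= psi_kernel n.+1%:R s by exact: ltW (psi_kernel_gt0 n0 s0).
    rewrite sub0r normrN (ger0_norm K0).
    apply: HT; apply: (@le_trans _ _ n%:R); last by rewrite ler_nat.
    by near: n; exact: nbhs_infty_ger.
  have lower (T0 : R) (h : R -> R) : {homo h : x y / x <= y} -> forall A, A <= h T0 ->
      forall t, Num.max 1 T0 <= t -> A * s <= h t * s.
    move=> ndh A AT t; rewrite ge_max => /andP[_ Tt].
    by rewrite ler_wpM2r ?(ltW s0)// (le_trans AT)// ndh.
  have T1 (T0 : R) : 0 < Num.max 1 T0 by rewrite lt_max ltr01.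
  case: growth => [/(_ (e ^- 2 / s))[T HT]|/(_ (e^-1 `^ (2 - q) / s))[T HT]].
  - exists (Num.max 1 T) => // t Tt.
    have t0 : 0 <= t by rewrite (le_trans _ Tt)// ltW.
    have := lower _ _ ndf _ HT _ Tt; rewrite divfK ?gt_eqF// => H.
    apply: psi_kernel_le => //.
    apply: (@le_trans _ _ (Num.sqrt (primitive f (t + s) - primitive f t))).
      rewrite -[leLHS]ger0_norm ?invr_ge0 ?(ltW e0)// -sqrtr_sqr ler_wsqrtr//.
      by rewrite exprVn (le_trans H)// increment_ge// ltW.
    by rewrite lerDl powR_ge0.
  - exists (Num.max 1 T) => // t Tt.
    have t0 : 0 <= t by rewrite (le_trans _ Tt)// ltW.
    have := lower _ _ ndg _ HT _ Tt; rewrite divfK ?gt_eqF// => H.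
    apply: psi_kernel_le => //.
    apply: (@le_trans _ _ ((primitive g (t + s) - primitive g t) `^ (2 - q)^-1)).
      have q2n : 2 - q != 0 by rewrite gt_eqF// subr_gt0.
      have -> : e^-1 = (e^-1 `^ (2 - q)) `^ (2 - q)^-1.
        by rewrite -powRrM divff// powRr1// invr_ge0 ltW.
      have G0 := increment_g_ge0 fg t0 (ltW s0).
      have GH := le_trans H (increment_ge t cg ndg (ltW s0)).
      apply: ge0_ler_powR => //; first by rewrite invr_ge0 subr_ge0 ltW.
      by rewrite nnegrE powR_ge0.
    by rewrite lerDr sqrtr_ge0.
have [|||||_ _ H] := @dominated_convergence _ _ R lebesgue_measure `]0, +oo[
  (measurable_itv _) (fun n s => (psi_kernel n.+1%:R s)%:E) (cst 0%E)
  (EFin \o psi_kernel 1).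
- by move=> n; exact: psi_kernel_measurable.
- exact: measurable_cst.
- apply: aeW => s /=; rewrite in_itv /= andbT => s0.
  by apply/fine_cvgP; split; [exact: nearW|exact: small].
- exact: psi_kernel_integrable.
- apply: aeW => s n /=; rewrite in_itv /= andbT => s0.
  have n0 : 0 <= n.+1%:R :> R by [].
  have K0 : 0 <= psi_kernel n.+1%:R s by exact: ltW (psi_kernel_gt0 n0 s0).
  rewrite lee_fin (ger0_norm K0).
  by apply: psi_kernel_nincr => //; rewrite ler1n.
move: H; rewrite integral0 => /fine_cvgP[_ /cvgrPdist_lt/(_ d d0)[N _ /(_ N (leqnn N))]].
rewrite /= sub0r normrN => H; exists N.+1%:R => //.
exact: le_lt_trans (ler_norm _) H.
Unshelve. all: by end_near. Qed.

(** Bounded [f] and [g] would make the denominator at most linear, and the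
    integral of [1 / s] diverges: along [exp], it grows at unit speed. *)
Lemma KO_unbounded : q <= 1 -> unbounded_above f \/ unbounded_above g.
Proof.
move=> q1; apply: contrapT => /not_orP[/existsNP[A1 nf] /existsNP[A2 ng]].
have {nf}fA t : f t <= A1 by rewrite leNgt; apply/negP => /ltW ?; apply: nf; exists t.
have {ng}gA t : g t <= A2 by rewrite leNgt; apply/negP => /ltW ?; apply: ng; exists t.
pose M := Num.max 1 (Num.max A1 A2).
have M1 : 1 <= M by rewrite le_max lexx.
have M0 : 0 < M by exact: lt_le_trans M1.
have lin (h : R -> R) : continuous h -> (forall t, h t <= M) ->
    forall s, 0 <= s -> primitive h s <= M * s.
  move=> ch hM s s0.
  have [c _] := MVT_segment s0 (fun z _ => is_derive_primitive z ch)
    (continuous_subspaceT (continuous_primitive ch)).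
  by rewrite primitive0 !subr0 => ->; rewrite ler_wpM2r.
pose k (s : R) := (2 * M) * (KO_denom q (primitive f s) (primitive g s))^-1.
have KOE (s : R) : (KO_denom q (primitive f s) (primitive g s))^-1 = psi_kernel 0 s.
  by rewrite /psi_kernel add0r !primitive0 !subr0.
have M20 : 0 < 2 * M by rewrite mulr_gt0.
have k_gt0 (s : R) : 1 < s -> 0 < k s.
  by move=> s1; rewrite /k KOE mulr_gt0// psi_kernel_gt0// (lt_trans _ s1).
have kcont (s : R) : 1 < s -> {for s, continuous k}.
  move=> s1; have -> : k = (fun s => 2 * M * psi_kernel 0 s).
    by apply/funext => x; rewrite /k KOE.
  apply: cvgM; first exact: cvg_cst.
  by apply: psi_kernel_continuous => //; rewrite (lt_trans _ s1).
have lower (s : R) : 1 < s -> 1 <= k s * s.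
  move=> s1; have s0 : 0 < s by exact: lt_trans s1.
  have D0 : 0 < KO_denom q (primitive f s) (primitive g s).
    by rewrite -invr_gt0 KOE psi_kernel_gt0.
  rewrite /k mulrAC ler_pdivlMr// mul1r.
  have Ms1 : 1 <= M * s by rewrite -(mulr1 1) ler_pM// ltW.
  have Ms0 : 0 <= M * s by exact: le_trans Ms1.
  have g0s : 0 <= primitive g s.
    by have := increment_g_ge0 fg (lexx 0) (ltW s0); rewrite add0r primitive0 subr0.
  apply: (@le_trans _ _ (KO_denom q (M * s) (M * s))).
    apply: le_KO_denom => //.
      by apply: lin; rewrite ?(ltW s0)// => t; rewrite !le_max fA orbT.
    by apply: lin; rewrite ?(ltW s0)// => t; rewrite !le_max gA !orbT.
  rewrite -mulrA mulr_natl mulr2n lerD//.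
    rewrite -[leRHS]ger0_norm// -sqrtr_sqr ler_wsqrtr//.
    by rewrite expr2 ler_peMr.
  apply: ler1_powR => //; rewrite invf_le1 ?subr_gt0//; lra.
pose I := (\int[lebesgue_measure]_(s in `]1%R, +oo[) (k s)%:E)%E.
have Iy : (I < +oo)%E.
  rewrite /I (_ : (fun s => _) = (fun s => (2 * M)%:E *
      ((KO_denom q (primitive f s) (primitive g s))^-1)%:E)%E)//.
  have mK (A : set R) : A `<=` `]0, +oo[ -> measurable_fun A
      (fun s : R => ((KO_denom q (primitive f s) (primitive g s))^-1)%:E).
    move=> A0; rewrite (_ : (fun s => _) = EFin \o psi_kernel 0).
      exact: psi_kernel_measurable.
    by apply/funext => s /=; rewrite KOE.
  have KO0 (s : R) : (0 <= ((KO_denom q (primitive f s) (primitive g s))^-1)%:E)%E.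
    by rewrite lee_fin invr_ge0 addr_ge0 ?sqrtr_ge0 ?powR_ge0.
  have sub1 : `]1, +oo[ `<=` (`]0, +oo[ : set R).
    by move=> s /=; rewrite !in_itv /= !andbT; exact: lt_trans.
  have sub1c : `[1, +oo[ `<=` (`]0, +oo[ : set R).
    by move=> s /=; rewrite !in_itv /= !andbT; exact: lt_le_trans.
  rewrite ge0_integralZl//; last 2 first.
  - exact: mK.
  - by rewrite lee_fin ltW.
  rewrite lte_mul_pinfty ?lee_fin ?(ltW M20)//.
  apply: le_lt_trans KO; apply: ge0_subset_integral => //; first exact: mK.
  by move=> s /=; rewrite !in_itv /= !andbT => /ltW.
have big (r : R) : 0 < r -> (r%:E <= I)%E.
  move=> r0; apply: (@radius_le_integral R 1 r expR expR) => //.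
  - exact: expR0.
  - by move=> x _; exact: expR_gt0.
  - move=> x /andP[x0 _]; apply: lower.
    by rewrite -expR0 ltr_expR.
have I0 : (0 <= I)%E by apply: le_trans (big 1 ltr01); rewrite lee_fin.
move: Iy I0 big; case: I => // i _; rewrite lee_fin => i0 /(_ (i + 1)).
by rewrite lee_fin => H; have := H (ltr_pwDr ltr01 i0); lra.
Qed.

End psi.

(** * Euclidean balls *)

Section euclid.
Context (R : realType) (n : nat).
Implicit Types x y c : 'rV[R]_n.

Lemma dotpp_ge0 x : 0 <= dotp x x.
Proof. by apply: sumr_ge0 => i _; rewrite -expr2 sqr_ge0. Qed.

Lemma sqr_enorm x : enorm x ^+ 2 = dotp x x.
Proof. by rewrite sqr_sqrtr ?dotpp_ge0. Qed.

Lemma enorm_ge0 x : 0 <= enorm x. Proof. exact: sqrtr_ge0. Qed.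

Lemma dotpZZ (k : R) x : dotp (k *: x) (k *: x) = k ^+ 2 * dotp x x.
Proof. by rewrite /dotp mulr_sumr; apply: eq_bigr => i _; rewrite !mxE; ring. Qed.

Lemma enormZ (k : R) x : enorm (k *: x) = `|k| * enorm x.
Proof. by rewrite /enorm dotpZZ sqrtrM ?sqr_ge0// sqrtr_sqr. Qed.

Lemma enormN x : enorm (- x) = enorm x.
Proof. by rewrite -scaleN1r enormZ normrN1 mul1r. Qed.

Lemma enorm0 : enorm (0 : 'rV[R]_n) = 0.
Proof. by rewrite -(scale0r (0 : 'rV[R]_n)) enormZ normr0 mul0r. Qed.

Lemma enorm_gt0 x : (0 < enorm x) = (x != 0).
Proof.
apply/idP/idP; first by apply: contraTneq => ->; rewrite enorm0 ltxx.
move=> xn; rewrite sqrtr_gt0 lt0r dotpp_ge0 andbT.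
apply: contra xn => /eqP x0; apply/eqP/rowP => i; rewrite mxE.
have := x0; rewrite /dotp => /eqP; rewrite psumr_eq0; last first.
  by move=> j _; rewrite -expr2 sqr_ge0.
by move=> /allP/(_ i (mem_index_enum _)); rewrite -expr2 sqrf_eq0 => /eqP.
Qed.

Lemma coord_le_enorm x i : `|x 0 i| <= enorm x.
Proof.
rewrite -sqrtr_sqr ler_wsqrtr// /dotp (bigD1 i)//= -expr2 lerDl.
by apply: sumr_ge0 => j _; rewrite -expr2 sqr_ge0.
Qed.

Lemma norm_le_enorm x : `|x| <= enorm x.
Proof.
rewrite [leLHS]/Num.norm /= mx_normrE; apply/bigmax_leP; split; first exact: enorm_ge0.
by move=> [i j] _; rewrite (ord1 i); exact: coord_le_enorm.
Qed.

Lemma continuous_coordB c (i : 'I_n) : continuous (fun x : 'rV[R]_n => x 0 i - c 0 i).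
Proof. move=> x; apply: (@cvgB _ R^o _ (nbhs x) (nbhs_filter x)).
  exact: coord_continuous.
exact: cvg_cst. Qed.

Lemma continuous_sqdist c :
  continuous (fun x : 'rV[R]_n => dotp (x - c) (x - c)).
Proof.
move=> x.
have H := (@cvg_big R^o 'I_n +%R 0 predT (@add_continuous R^o) _ (nbhs x) (index_enum _)
  (fun i (y : 'rV[R]_n) => (y - c) 0 i * (y - c) 0 i)
  (fun i => (x - c) 0 i * (x - c) 0 i) (nbhs_filter x)).
apply: H => i _.
rewrite (_ : (fun y : 'rV[R]_n => _) = (fun y => (y 0 i - c 0 i) * (y 0 i - c 0 i))); last first.
  by apply/funext => y; rewrite !mxE.
by rewrite !mxE; apply: (@cvgM R _ (nbhs x) (nbhs_filter x)); exact: continuous_coordB.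
Qed.

Lemma continuous_edist c : continuous (fun x : 'rV[R]_n => enorm (x - c)).
Proof.
move=> x; apply: (@continuous_comp _ _ _ (fun x => dotp (x - c) (x - c)) Num.sqrt).
  exact: continuous_sqdist.
exact: sqrt_continuous.
Qed.

Definition eball c (r : R) : set 'rV[R]_n := [set x | enorm (x - c) <= r].

Lemma eball_compact c r : compact (eball c r).
Proof.
apply: bounded_closed_compact.
  exists (r + `|c|); split; first exact: num_real.
  move=> M rM x /= xr; apply: le_trans (ltW rM).
  rewrite -(subrK c x); apply: le_trans (ler_normD _ _) _.
  by rewrite lerD2r (le_trans (norm_le_enorm _)).
rewrite /eball (_ : [set x | _] = (fun x => enorm (x - c)) @^-1` [set y | y <= r])//.
apply: closed_comp; last exact: closed_le.
by move=> x _; exact: continuous_edist.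
Qed.

(** A segment from a point of [Omega] to a point outside first leaves [Omega]
    at a boundary point. *)
Lemma lt_dist_boundary (Omega : set 'rV[R]_n) x z : open Omega -> Omega x ->
  enorm (z - x) < dist_boundary Omega x -> Omega z.
Proof.
move=> oO Ox; apply: contraPP => nOz; apply/negP; rewrite -leNgt.
pose p t : 'rV[R]_n := x + t *: (z - x).
have cp : continuous p.
  move=> t; apply: cvgD; first exact: cvg_cst.
  by apply: cvgZ; [exact: cvg_id|exact: cvg_cst].
have p0 : p 0 = x by rewrite /p scale0r addr0.
have p1 : p 1 = z by rewrite /p scale1r addrC subrK.
pose S : set R := [set t | 0 <= t <= 1 /\ ~ Omega (p t)].
have S1 : S 1 by split; rewrite ?lexx ?ler01// p1.
have lbS : lbound S 0 by move=> t [/andP[]].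
have hS : has_inf S by split; [exists 1|exists 0].
pose s := inf S.
have s0 : 0 <= s by apply: lb_le_inf => //; exists 1.
have hl : has_lbound S by exists 0.
have s1 : s <= 1 by exact: ge_inf.
have nearO t : Omega (p t) -> exists2 e, 0 < e & forall t', `|t - t'| < e -> Omega (p t').
  move=> Opt; have : \forall t' \near t, Omega (p t').
    by apply: cp; exact: open_nbhs_nbhs.
  by move=> /nbhs_ballP[e e0 he]; exists e => // t' tt'; exact: he.
have nOs : ~ Omega (p s).
  move=> /nearO[e e0 he].
  have [t [t01 nOt] te] := inf_adherent e0 hS.
  have st : s <= t by exact: ge_inf.
  by apply: nOt; apply: he; rewrite distrC ger0_norm ?subr_ge0// ltrBlDl.
have s_gt0 : 0 < s.
  by rewrite lt0r s0 andbT; apply: contra_notN nOs => /eqP ->; rewrite p0.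
have bs : boundary Omega (p s).
  split; last by move=> /interior_subset.
  move=> B Bps.
  have : \forall t' \near s, B (p t') by exact: cp.
  move=> /nbhs_ballP[e e0 he].
  pose t := Num.max 0 (s - e / 2).
  have ts : t < s by rewrite gt_max s_gt0 /= ltrBlDr ltrDl divr_gt0.
  exists (p t); split.
    apply: contrapT => nOt.
    have : s <= t.
      apply: ge_inf => //.
      by split=> //; rewrite le_max lexx /= (le_trans (ltW ts)).
    by rewrite leNgt ts.
  apply: he; rewrite /ball /= gtr0_norm ?subr_gt0// ltrBlDl -ltrBlDr.
  by rewrite lt_max; apply/orP; right; rewrite ltrD2l ltrN2 ltr_pdivrMr// ltr_pMr// ltr1n.
apply: (@le_trans _ _ (enorm (x - p s))).
  apply: ge_inf; last by exists (p s).
  by exists 0 => _ [y _ <-]; exact: enorm_ge0.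
rewrite /p opprD addNKr || rewrite /p opprD addrA subrr add0r.
by rewrite enormN enormZ ger0_norm// ler_piMl// enorm_ge0.
Qed.

Lemma dist_boundary_gt0 (Omega : set 'rV[R]_n) x : open Omega -> Omega x ->
  boundary Omega !=set0 -> 0 < dist_boundary Omega x.
Proof.
move=> oO Ox [b bb].
have /nbhs_ballP[e e0 he] : nbhs x Omega by exact: open_nbhs_nbhs.
apply: lt_le_trans e0 _; apply: lb_le_inf; first by exists (enorm (x - b)), b.
move=> _ [y [_ nOy] <-]; rewrite leNgt; apply/negP => xy; apply: nOy.
have -> : Omega^° = Omega by exact/interior_id.
by apply: he; rewrite -ball_normE /=; exact: le_lt_trans (norm_le_enorm _) xy.
Qed.

End euclid.

(** The superlevel sets [w y <= w x] form a filter base on [K], and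
    upper semicontinuity makes any cluster point a maximum point. *)
Lemma usc_compact_max (R : realType) (T : topologicalType) (K : set T) (w : T -> R) :
  compact K -> K !=set0 ->
  (forall x, K x -> forall e, 0 < e -> \forall y \near x, K y -> w y < w x + e) ->
  exists2 z, K z & forall y, K y -> w y <= w z.
Proof.
move=> cK [k0 Kk0] usc.
pose B y := [set x | K x /\ w y <= w x].
pose F := filter_from K B.
have FF : ProperFilter F.
  apply: filter_from_proper; last by move=> y Ky; exists y; split.
  apply: filter_from_filter; first by exists k0.
  move=> y1 y2 K1 K2; have [l12|/ltW l21] := leP (w y1) (w y2).
    by exists y2 => // x [Kx h]; split; split => //; exact: le_trans h.
  by exists y1 => // x [Kx h]; split; split => //; exact: le_trans h.
have FK : F K by exists k0 => // x [].
have [z [Kz cz]] := cK _ FF FK.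
exists z => // y Ky; rewrite leNgt; apply/negP => zy.
have yz0 : 0 < w y - w z by rewrite subr_gt0.
have FB : F (B y) by exists y.
have [x [[Kx yx]]] := cz _ _ FB (usc z Kz _ yz0).
by move=> /(_ Kx); rewrite addrC subrK ltNge yx.
Qed.

(** * Radial test functions *)

(** A quadratic polynomial in the squared distance to [c]. Being a polynomial,
    it is [C^2] everywhere, the center included, where a radial function of
    [|x - c|] would need a separate discussion. *)
Section test_function.
Context (R : realType) (n : nat) (c : 'rV[R]_n) (al be ga tau : R).
Implicit Types x y : 'rV[R]_n.

Definition radial_test x : R :=
  let s := dotp (x - c) (x - c) - tau in al + be * s + ga * s ^+ 2.

Definition radial_test1 (i : 'I_n) x : R :=
  (be + 2 * ga * (dotp (x - c) (x - c) - tau)) * (2 * (x 0 i - c 0 i)).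

Definition radial_test2 (i j : 'I_n) x : R :=
  2 * ga * (2 * (x 0 j - c 0 j)) * (2 * (x 0 i - c 0 i)) +
  (be + 2 * ga * (dotp (x - c) (x - c) - tau)) * (2 * (i == j)%:R).

Lemma is_derive_coordB (i j : 'I_n) x :
  is_derive x (delta_mx 0 j) (fun y : 'rV[R]_n => y 0 i - c 0 i) (i == j)%:R.
Proof.
have E : (fun h : R => h^-1 *: ((fun y : 'rV[R]_n => y 0 i - c 0 i) (h *: delta_mx 0 j + x)
    - (x 0 i - c 0 i))) @ 0^' --> ((i == j)%:R : R).
  apply: cvg_trans (@cvg_cst _ ((i == j)%:R : R) _ (0^') _).
  apply: near_eq_cvg; near=> h.
  have hn : h != 0 by near: h; exact: nbhs_dnbhs_neq.
  rewrite !mxE eqxx /= /GRing.scale /=; field.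
  exact: hn.
by apply: DeriveDef; [apply/cvg_ex; exists (i == j)%:R|exact: cvg_lim].
Unshelve. all: by end_near. Qed.

Lemma is_derive_sqdist (j : 'I_n) x :
  is_derive x (delta_mx 0 j) (fun y : 'rV[R]_n => dotp (y - c) (y - c) - tau)
    (2 * (x 0 j - c 0 j)).
Proof.
have H := @is_derive_sum R _ _ n (fun i y => (y 0 i - c 0 i) * (y 0 i - c 0 i))
  x (delta_mx 0 j) _ (fun i => is_deriveM (is_derive_coordB i j x) (is_derive_coordB i j x)).
have H2 := is_deriveB H (is_derive_cst tau x (delta_mx 0 j)).
rewrite (_ : (fun y => _) = (\sum_(i < n) (fun y : 'rV[R]_n =>
    (y 0 i - c 0 i) * (y 0 i - c 0 i))) - cst tau); last first.
  apply/funext => y; rewrite /GRing.add /= /GRing.opp /= fct_sumE; congr (_ - _).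
  by apply: eq_bigr => i _; rewrite !mxE.
apply: is_derive_eq.
rewrite subr0 (bigD1 j)//= eqxx big1 ?addr0.
  by rewrite /GRing.scale /=; ring.
by move=> i /negbTE ->; rewrite !scaler0 addr0.
Qed.

Lemma is_derive_radial_test (i : 'I_n) x :
  is_derive x (delta_mx 0 i) radial_test (radial_test1 i x).
Proof.
have D := is_derive_sqdist i x.
have D2 := is_deriveM D D.
have H := is_deriveD (is_deriveZ be D) (is_deriveZ ga D2).
have H2 := is_deriveD (is_derive_cst al x (delta_mx 0 i)) H.
have -> : radial_test = cst al + (be *: (fun y => dotp (y - c) (y - c) - tau) +
   ga *: ((fun y => dotp (y - c) (y - c) - tau) * (fun y => dotp (y - c) (y - c) - tau))).
  by apply/funext => y; rewrite /radial_test expr2 addrA.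
apply: is_derive_eq; rewrite /radial_test1 /GRing.scale /=. ring.
Qed.

Lemma is_derive_radial_test1 (i j : 'I_n) x :
  is_derive x (delta_mx 0 j) (radial_test1 i) (radial_test2 i j x).
Proof.
have D := is_derive_sqdist j x.
have H := is_deriveD (is_derive_cst be x (delta_mx 0 j)) (is_deriveZ (2 * ga) D).
have H2 := is_deriveM H (is_deriveZ 2 (is_derive_coordB i j x)).
have -> : radial_test1 i = (cst be + (2 * ga) *: (fun y => dotp (y - c) (y - c) - tau)) *
   (2 *: (fun y : 'rV[R]_n => y 0 i - c 0 i)).
  by apply/funext.
apply: is_derive_eq.
change ((be + 2 * ga * (dotp (x - c) (x - c) - tau)) * (2 * (i == j)%:R) +
  2 * (x 0 i - c 0 i) * (0 + 2 * ga * (2 * (x 0 j - c 0 j))) = radial_test2 i j x).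
by rewrite /radial_test2; ring.
Qed.

Lemma partial_radial_test (i : 'I_n) : partial i radial_test = radial_test1 i.
Proof. by apply/funext => x; have [_] := is_derive_radial_test i x. Qed.

Lemma partial_radial_test1 (i j : 'I_n) :
  partial j (radial_test1 i) = radial_test2 i j.
Proof. by apply/funext => x; have [_] := is_derive_radial_test1 i j x. Qed.

Lemma continuous_sqdistB : continuous (fun x => dotp (x - c) (x - c) - tau).
Proof.
move=> x; apply: (@cvgB _ R^o _ (nbhs x) (nbhs_filter x)).
  exact: continuous_sqdist.
exact: (@cvg_cst _ _ _ (nbhs x) (nbhs_filter x)).
Qed.

Lemma radial_test_C2 x : C2_near radial_test x.
Proof.
rewrite /C2_near; apply: (@filterE _ (nbhs x) (nbhs_filter x)) => y.
have cs := continuous_sqdistB (x := y).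
have cc i := @continuous_coordB R n c i y.
have FF := nbhs_filter y.
have cfac : (be + 2 * ga * (dotp (x - c) (x - c) - tau)) @[x --> nbhs y] -->
    be + 2 * ga * (dotp (y - c) (y - c) - tau).
  apply: (@cvgD _ R^o _ (nbhs y) FF); first exact: (@cvg_cst _ _ _ (nbhs y) FF).
  by apply: (@cvgM R _ (nbhs y) FF); [exact: (@cvg_cst _ _ _ (nbhs y) FF)|exact: cs].
split.
- apply: (@cvgD _ R^o _ (nbhs y) FF).
    apply: (@cvgD _ R^o _ (nbhs y) FF); first exact: (@cvg_cst _ _ _ (nbhs y) FF).
    by apply: (@cvgM R _ (nbhs y) FF); [exact: (@cvg_cst _ _ _ (nbhs y) FF)|exact: cs].
  apply: (@cvgM R _ (nbhs y) FF); first exact: (@cvg_cst _ _ _ (nbhs y) FF).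
  by apply: (@cvgM R _ (nbhs y) FF); exact: cs.
- move=> i; split; first by have [] := is_derive_radial_test i y.
  rewrite partial_radial_test; apply: (@cvgM R _ (nbhs y) FF); first exact: cfac.
  by apply: (@cvgM R _ (nbhs y) FF); [exact: (@cvg_cst _ _ _ (nbhs y) FF)|exact: cc].
- move=> i j; rewrite partial_radial_test partial_radial_test1.
  split; first by have [] := is_derive_radial_test1 i j y.
  apply: (@cvgD _ R^o _ (nbhs y) FF).
    apply: (@cvgM R _ (nbhs y) FF).
      apply: (@cvgM R _ (nbhs y) FF); first exact: (@cvg_cst _ _ _ (nbhs y) FF).
      by apply: (@cvgM R _ (nbhs y) FF); [exact: (@cvg_cst _ _ _ (nbhs y) FF)|exact: cc].
    by apply: (@cvgM R _ (nbhs y) FF); [exact: (@cvg_cst _ _ _ (nbhs y) FF)|exact: cc].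
  by apply: (@cvgM R _ (nbhs y) FF); [exact: cfac|exact: (@cvg_cst _ _ _ (nbhs y) FF)].
Qed.

Section at_radius.
Variable z : 'rV[R]_n.
Hypothesis ztau : dotp (z - c) (z - c) = tau.

Lemma gradient_radial_test : gradient radial_test z = (2 * be) *: (z - c).
Proof.
apply/rowP => i; rewrite !mxE partial_radial_test /radial_test1 ztau subrr.
by rewrite mulr0 addr0; ring.
Qed.

Lemma quad_form_radial_test (e : 'rV[R]_n) :
  quad_form (hessian radial_test z) e =
  8 * ga * dotp e (z - c) ^+ 2 + 2 * be * dotp e e.
Proof.
pose w := z - c.
have hE i j : hessian radial_test z i j = 8 * ga * (w 0 i * w 0 j) + 2 * be * (i == j)%:R.
  rewrite !mxE partial_radial_test partial_radial_test1 /radial_test2 ztau subrr /=.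
  by rewrite mulr0 addr0; ring.
rewrite {1}/quad_form {1}/dotp.
under eq_bigr => j _.
  rewrite mxE.
  under eq_bigr => i _ do rewrite [X in _ * X]mxE hE.
  have -> : \sum_(i < n) e 0 i * (8 * ga * (w 0 j * w 0 i) + 2 * be * (j == i)%:R)
      = 8 * ga * w 0 j * dotp e w + 2 * be * e 0 j.
    under eq_bigr => i _ do rewrite mulrDr.
    rewrite big_split /=; congr (_ + _).
      by rewrite /dotp mulr_sumr; apply: eq_bigr => i _; ring.
    rewrite (bigD1 j)//= eqxx big1 ?addr0 /=; first by ring.
    by move=> i ij; rewrite eq_sym (negbTE ij) !mulr0.
  over.
under eq_bigr => j _ do rewrite mulrDl.
rewrite big_split /=; congr (_ + _).
  rewrite -/w expr2 mulrA [X in _ = _ * X]/dotp mulr_sumr.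
  by apply: eq_bigr => i _; ring.
by rewrite /dotp mulr_sumr; apply: eq_bigr => i _; ring.
Qed.

(** As a function of the radius [r], the second derivative of the test
    function at [r ^ 2 = tau] is the same number; at the center all directions
    give [2 * be]. *)
Lemma inf_laplacian_radial_test : (0 < n)%N -> 0 < be ->
  inf_laplacian_plus radial_test z = 8 * ga * tau + 2 * be.
Proof.
move=> n0 be0; rewrite /inf_laplacian_plus gradient_radial_test.
have b2 : 2 * be != 0 by rewrite mulf_neq0// gt_eqF.
case: ifPn => [|].
  rewrite scaler_eq0 negb_or b2 /= => wn.
  have tau0 : tau != 0.
    by rewrite -ztau -sqr_enorm sqrf_eq0 gt_eqF// enorm_gt0.
  have E : dotp ((2 * be) *: (z - c)) (z - c) = 2 * be * tau.
    rewrite -ztau /dotp mulr_sumr; apply: eq_bigr => i _.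
    by rewrite !mxE mulrA.
  rewrite quad_form_radial_test sqr_enorm dotpZZ E ztau; field.
  by rewrite tau0 gt_eqF.
rewrite negbK scaler_eq0 (negbTE b2) /= => /eqP w0.
have -> : tau = 0 by rewrite -ztau w0 /dotp big1// => i _; rewrite mxE mul0r.
rewrite mulr0 add0r.
have -> : [set quad_form (hessian radial_test z) e | e in [set e | enorm e = 1]]
    = [set 2 * be].
  apply/seteqP; split => [_ [e /= e1 <-]|_ ->].
    rewrite quad_form_radial_test w0 -sqr_enorm e1.
    rewrite (_ : dotp e 0 = 0) ?expr0n /=; first by ring.
    by rewrite /dotp big1// => i _; rewrite [X in _ * X]mxE mulr0.
  pose e : 'rV[R]_n := delta_mx 0 (Ordinal n0).
  have ee : dotp e e = 1.
    rewrite /dotp (bigD1 (Ordinal n0))//= big1 ?addr0; first by rewrite mxE !eqxx mulr1.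
    by move=> i /negbTE ij; rewrite mxE ij andbF mul0r.
  exists e => /=; first by rewrite /enorm ee sqrtr1.
  rewrite quad_form_radial_test w0 ee.
  rewrite (_ : dotp e 0 = 0) ?expr0n /=; first by ring.
  by rewrite /dotp big1// => i _; rewrite [X in _ * X]mxE mulr0.
exact: sup1.
Qed.

End at_radius.

End test_function.

(** * Comparison *)

Lemma second_derivative_min (R : realType) (h h1 : R -> R) (b r0 l : R) :
  (forall r, 0 <= r <= b -> is_derive r 1 h (h1 r)) ->
  0 <= r0 <= b -> h1 r0 = 0 -> is_derive r0 1 h1 l -> 0 < l ->
  exists2 d, 0 < d & forall r, 0 <= r <= b -> `|r0 - r| < d -> h r0 <= h r.
Proof.
move=> dh /andP[r00 r0b] h1r0 /is_derive1_caratheodory[G [GE cG Gr0]] l0.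
have : \forall y \near G r0, 0 < y by apply: lt_nbhsr; rewrite Gr0.
move=> /cG/nbhs_ballP[d d0 hd]; exists d => // r /andP[r_0 rb] rd.
have h1E (s : R) : h1 s = G s * (s - r0) by rewrite -GE h1r0 subr0.
have Gs (s : R) : `|r0 - s| <= `|r0 - r| -> 0 < G s.
  by move=> sr; apply: hd; exact: le_lt_trans rd.
have mvt (x y : R) : 0 <= x -> x <= y -> y <= b ->
    exists2 s, x <= s <= y & h y - h x = h1 s * (y - x).
  move=> x0 xy yb.
  have dh' s : s \in `]x, y[%R -> is_derive s 1 h (h1 s).
    rewrite in_itv /= => /andP[xs sy]; apply: dh.
    by rewrite (le_trans x0 (ltW xs)) (le_trans (ltW sy) yb).
  have ch : {within `[x, y], continuous h}.
    have dW s : `[x, y]%classic s -> is_derive s 1 h (h1 s).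
      rewrite /= in_itv /= => /andP[xs sy]; apply: dh.
      by rewrite (le_trans x0 xs) (le_trans sy yb).
    exact: (is_derive_within_continuous dW).
  have [s sxy E] := MVT_segment xy dh' ch.
  by exists s => //; move: sxy; rewrite in_itv.
have [rr0|/ltW r0r] := leP r r0.
- have [s /andP[rs sr0] E] := mvt r r0 r_0 rr0 r0b.
  rewrite -subr_le0 E h1E -mulrA pmulr_rle0; last first.
    by apply: Gs; rewrite !ger0_norm ?subr_ge0// lerD2l lerN2.
  by rewrite mulr_le0_ge0 ?subr_le0 ?subr_ge0.
- have [s /andP[r0s sr] E] := mvt r0 r r00 r0r rb.
  rewrite -subr_ge0 E h1E -mulrA pmulr_rge0; last first.
    by apply: Gs; rewrite !(distrC r0) !ger0_norm ?subr_ge0// lerD2r.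
  by rewrite mulr_ge0 ?subr_ge0.
Qed.

(** [phi] solves the problem with [l * f] in place of [f]. *)
Section comparison.
Context (R : realType) (n : nat) (Omega : set 'rV[R]_n) (f g : R -> R) (q : R).
Context (u : 'rV[R]_n -> R).
Hypotheses (n_gt0 : (0 < n)%N) (fg : nondecreasing_cont_sign f g).
Hypothesis u_sub : viscosity_subsolution f g q Omega u.

Lemma usc_bounded (K : set 'rV[R]_n) : compact K -> K !=set0 -> K `<=` Omega ->
  exists M, forall x, K x -> u x <= M.
Proof.
case: u_sub => uscu _ cK K0 KO.
have [x Kx e e0|z Kz zmax] := @usc_compact_max R _ K u cK K0; last by exists (u z).
by move: (uscu x (KO _ Kx) e e0); apply: filterS => y h /KO; exact: h.
Qed.

Context (l a r0 M : R) (phi phi1 : R -> R) (c : 'rV[R]_n).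
Hypotheses (l_gt0 : 0 < l) (l_lt1 : l < 1) (a0 : 0 < a).
Hypotheses (r0_gt0 : 0 < r0) (phi_0 : phi 0 = a) (phi1_0 : phi1 0 = 0).
Hypothesis dphi : forall r, 0 <= r <= r0 -> is_derive r 1 phi (phi1 r).
Hypothesis dphi1 : forall r, 0 <= r <= r0 ->
  is_derive r 1 phi1 (l * f (phi r) + g (phi r) * `|phi1 r| `^ q).
Hypothesis phi1_gt0 : forall r, 0 < r <= r0 -> 0 < phi1 r.
Hypothesis ball_Omega : eball c r0 `<=` Omega.
Hypothesis uM : forall x, eball c r0 x -> u x <= M.
Hypothesis phiM : M < phi r0.

(** If [u c > a], then [u - phi (|x - c|)] has a positive interior maximum on the
    ball, at some [z] of radius [r]. The polynomial test function with the
    value and slope of [phi] at [r], and second derivative larger by [e],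
    touches from above there, and the subsolution inequality contradicts
    [l * f (phi r) + e < f (phi r) <= f (u z)]. *)
Lemma comparison : u c <= a.
Proof.
rewrite leNgt; apply/negP => auc.
case: u_sub => uscu visc.
pose d x := enorm (x - c).
have dd x : d x ^+ 2 = dotp (x - c) (x - c) by exact: sqr_enorm.
have d0 x : 0 <= d x by exact: enorm_ge0.
have cd : continuous d by exact: continuous_edist.
have dc : d c = 0 by rewrite /d subrr enorm0.
pose w x := u x - phi (d x).
have Kc : eball c r0 c by rewrite /eball /= -/(d c) dc ltW.
have cphi r : 0 <= r <= r0 -> {for r, continuous phi}.
  by move=> /dphi; exact: is_derive_continuous.
have [x Kx e e0|z Kz zmax] := @usc_compact_max R _ (eball c r0) w
  (@eball_compact _ _ c r0) (ex_intro _ c Kc).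
- have e20 : 0 < e / 2 by rewrite divr_gt0.
  have dx : 0 <= d x <= r0 by rewrite d0.
  have near_phi : \forall y \near x, `|phi (d x) - phi (d y)| < e / 2.
    have cpd : {for x, continuous (phi \o d)} by exact: (continuous_comp (@cd x) (cphi _ dx)).
    by move/cvgrPdist_lt : cpd; apply.
  move: (uscu x (ball_Omega Kx) _ e20) near_phi; apply: filterS2 => y uy phiy Ky.
  have {}uy := uy (ball_Omega Ky).
  by move: phiy; rewrite /w ltr_norml => /andP[]; lra.
have wz : 0 < w z.
  by apply: lt_le_trans (zmax c Kc); rewrite /w dc phi_0 subr_gt0.
pose r := d z.
have r_ge0 : 0 <= r by exact: d0.
have rr0 : r < r0.
  rewrite lt_neqAle Kz andbT; apply: contraTneq wz => rE.
  rewrite /w -/r rE -leNgt subr_le0; apply: le_trans (ltW phiM); exact: uM.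
have r01 : 0 <= r <= r0 by rewrite r_ge0 ltW.
have phir_gt0 : 0 < phi r.
  move: r_ge0; rewrite le_eqVlt => /predU1P[<-|r_gt0]; first by rewrite phi_0.
  apply: lt_trans a0 _; rewrite -phi_0.
  by apply: (ivp_incr dphi phi1_gt0) => //; exact: ltW.
have [[ndf ndg] _ fs _ gs] := fg.
have fphi : 0 < f (phi r) by have [] := fs _ phir_gt0.
have phi1_ge0 : 0 <= phi1 r.
  move: r_ge0; rewrite le_eqVlt => /predU1P[<-|r_gt0]; first by rewrite phi1_0.
  by rewrite ltW// phi1_gt0// r_gt0 ltW.
(* half of the gap left by l < 1 *)
pose e := (1 - l) * f (phi r) / 2.
have e0 : 0 < e by rewrite divr_gt0// mulr_gt0// subr_gt0.
pose E := l * f (phi r) + g (phi r) * `|phi1 r| `^ q + e.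
have E0 : 0 < E.
  by rewrite ltr_wpDl// addr_ge0// ?mulr_ge0 ?powR_ge0 ?gs// ltW.
(* be and ga prescribe the first and second radial derivatives at r; for r = 0
   the first one vanishes anyway, be carries the second, and the division by
   zero gives ga = 0 *)
pose be := if r == 0 then E / 2 else phi1 r / (2 * r).
pose ga := (E - 2 * be) / (8 * r ^+ 2).
have be_gt0 : 0 < be.
  rewrite /be; case: eqVneq => [_|rn]; first by rewrite divr_gt0.
  have r_gt0 : 0 < r by rewrite lt0r rn.
  by rewrite divr_gt0 ?mulr_gt0// phi1_gt0// r_gt0 ltW.
have beE : 2 * be * r = phi1 r.
  rewrite /be; case: eqVneq => [->|rn]; first by rewrite mulr0 phi1_0.
  by field.
have gaE : 8 * ga * r ^+ 2 + 2 * be = E.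
  rewrite /ga /be; case: eqVneq => [->|rn]; first by rewrite expr0n /= mulr0; field.
  by field.
pose h (s : R) :=
  phi r + (be * (s ^+ 2 - r ^+ 2) + ga * (s ^+ 2 - r ^+ 2) ^+ 2) - phi s.
pose h1 (s : R) := 2 * be * s + 4 * ga * (s * (s ^+ 2 - r ^+ 2)) - phi1 s.
have dsq (s : R) : is_derive s 1 (fun s : R => s ^+ 2 - r ^+ 2) (2 * s).
  have := is_derive_add_cst (- r ^+ 2) (@is_derive_sqr R id s 1 (is_derive_id _ _)).
  by rewrite mulr1; under eq_fun do rewrite addrC.
have dh s : 0 <= s <= r0 -> is_derive s 1 h (h1 s).
  move=> sr.
  have D1 := is_deriveZ be (dsq s).
  have D2 := is_deriveZ ga (is_derive_sqr (dsq s)).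
  have D3 := is_deriveB (is_derive_add_cst (phi r) (is_deriveD D1 D2)) (dphi sr).
  have -> : h = (fun s => phi r + (be *: (fun s : R => s ^+ 2 - r ^+ 2) +
      ga *: (fun s : R => (s ^+ 2 - r ^+ 2) ^+ 2)) s) - phi.
    by apply/funext.
  apply: is_derive_eq; rewrite /h1 /GRing.scale /=; ring.
have dh1 : is_derive r 1 h1 e.
  have D1 := is_deriveZ (2 * be) (@is_derive_id R R r 1).
  have D2 := is_deriveZ (4 * ga) (is_deriveM (@is_derive_id R R r 1) (dsq r)).
  have D3 := is_deriveB (is_deriveD D1 D2) (dphi1 r01).
  have -> : h1 = ((2 * be) *: id + (4 * ga) *: (id * (fun s : R => s ^+ 2 - r ^+ 2))) - phi1.
    by apply/funext.
  apply: is_derive_eq; rewrite /GRing.scale /= subrr.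
  rewrite -[e](addrK (l * f (phi r) + g (phi r) * `|phi1 r| `^ q)) (addrC e) -/E -gaE.
  ring.
have h1r : h1 r = 0 by rewrite /h1 subrr !mulr0 addr0 beE subrr.
have [de de0 hmin] := second_derivative_min dh r01 h1r dh1 e0.
pose V := radial_test c (phi r) be ga (r ^+ 2).
have VE y : V y = h (d y) + phi (d y).
  by rewrite /V /radial_test -dd /h subrK addrA.
have zr : dotp (z - c) (z - c) = r ^+ 2 by rewrite -dd.
have touch : \forall y \near z, Omega y -> u y - V y <= u z - V z.
  have n1 : \forall y \near z, `|r - d y| < de.
    exact: (@cd z _ (nbhsx_ballx (d z) de de0)).
  have n2 : \forall y \near z, d y < r0.
    exact: (@cd z _ (lt_nbhsl rr0)).
  move: n1 n2; apply: filterS2 => y y1 y2 _.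
  have wy : w y <= w z by apply: zmax; rewrite /eball /= -/(d y) ltW.
  have hy : h r <= h (d y) by apply: hmin => //; rewrite d0 ltW.
  have hr : h r = 0 by rewrite /h subrr expr0n /= !mulr0 !addr0 subrr.
  by move: wy hy; rewrite /w !VE -/r hr; lra.
have := visc z V (ball_Omega Kz) (@radial_test_C2 _ _ _ _ _ _ _ z) touch.
rewrite (inf_laplacian_radial_test _ _ zr n_gt0 be_gt0) (gradient_radial_test _ _ _ zr).
rewrite enormZ -/(d z) -/r ger0_norm ?mulr_ge0 ?(ltW be_gt0)// beE gaE /E.
rewrite (ger0_norm phi1_ge0) => H.
have uz : phi r <= u z by move: wz; rewrite /w subr_gt0 => /ltW.
have fu := ndf _ _ uz.
have gu : g (phi r) * phi1 r `^ q <= g (u z) * phi1 r `^ q.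
  by rewrite ler_wpM2r ?powR_ge0// ndg.
have : (1 - l) * f (phi r) <= e by move: H fu gu; lra.
rewrite /e; have : 0 < (1 - l) * f (phi r) by rewrite mulr_gt0// subr_gt0.
lra.
Qed.

End comparison.

(** * The boundary estimate *)

Section estimate.
Context (R : realType) (n : nat) (Omega : set 'rV[R]_n).
Context (q C : R) (f g : R -> R) (u : 'rV[R]_n -> R).
Hypothesis Omega_open : open Omega.
Hypotheses (q0 : 0 < q) (q2 : q < 2) (C_bound : gradient_bound_constant q C).
Hypotheses (fg : nondecreasing_cont_sign f g) (KO : keller_osserman f g q).
Hypothesis u_sub : viscosity_subsolution f g q Omega u.

(** The gradient bound for the pair [m ^ 2 * f, g] separates variables:
    [phi' >= C * m * D (phi)] with [D] the denominator of [Psi], hence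
    [r0 <= \int 1 / (C m D) = Psi a / m]. *)
Lemma blowup_radius_le (m a r0 : R) (phi phi1 : R -> R) :
  0 < m -> m <= 1 -> 0 < a -> 0 < r0 -> phi 0 = a -> phi1 0 = 0 ->
  (forall r, 0 <= r <= r0 -> is_derive r 1 phi (phi1 r)) ->
  (forall r, 0 <= r <= r0 ->
    is_derive r 1 phi1 (m ^+ 2 * f (phi r) + g (phi r) * `|phi1 r| `^ q)) ->
  (forall r, 0 < r <= r0 -> 0 < phi1 r) ->
  r0 <= C^-1 * psi f g q a / m.
Proof.
move=> m0 m1 a0 r0_gt0 phi_0 phi1_0 dphi dphi1 phi1_gt0.
have [C0 bound] := C_bound.
have [_ [cf cg] _ _ _] := fg.
have fgm : nondecreasing_cont_sign (fun t => m ^+ 2 * f t) g.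
  by apply: nondecreasing_cont_sign_scale => //; rewrite exprn_gt0.
pose D s := KO_denom q (primitive f s - primitive f a) (primitive g s - primitive g a).
have D0 s : a < s -> 0 < D s.
  by move=> as_; apply: (KO_denom_increment_gt0 _ fg (ltW a0) as_).
pose k s := (C * m)^-1 * (D s)^-1.
have Cm0 : 0 < C * m by rewrite mulr_gt0.
have cD s : a < s -> {for s, continuous (fun s => (D s)^-1)}.
  by move=> as_; apply: (@inv_KO_increment_continuous _ _ _ _ q2 fg _ _ (ltW a0) as_).
have k0 s : a < s -> 0 < k s.
  by move=> /D0 Ds; rewrite mulr_gt0 ?invr_gt0.
have ck s : a < s -> {for s, continuous k}.
  by move=> as_; apply: cvgM; [exact: cvg_cst|exact: cD].
have kphi r : 0 < r < r0 -> 1 <= k (phi r) * phi1 r.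
  move=> /andP[r_0 rr0].
  have ap : a < phi r.
    by rewrite -phi_0; apply: (ivp_incr dphi phi1_gt0) => //; exact: ltW.
  have sol := ivp_solution_of_derive q0 fgm phi_0 phi1_0 dphi dphi1.
  have rr : 0 < r < r0 by rewrite r_0.
  have := bound _ _ fgm _ _ _ _ _ a0 r0_gt0 sol r rr.
  rewrite !primitive_scale// -mulrBr => H.
  have m2 : 0 <= m ^+ 2 <= 1 by rewrite sqr_ge0 expr_le1// ltW.
  have := KO_denom_scale q (primitive f (phi r) - primitive f a)
    (primitive g (phi r) - primitive g a) m2.
  rewrite sqrtr_sqr gtr0_norm// -/(D (phi r)) => H2.
  rewrite /k -invfM mulrC ler_pdivlMr ?mulr_gt0 ?D0// mul1r.
  by apply: le_trans H; rewrite -mulrA ler_pM2l.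
have := radius_le_integral phi_0 dphi phi1_gt0 k0 ck kphi.
rewrite (_ : (\int[_]_(_ in _) _)%E = ((m^-1)%:E * Psi f g q C a)%E).
  by rewrite (PsiE q2 fg KO)// -EFinM lee_fin mulrC.
rewrite /Psi muleA -EFinM -invfM (mulrC m) -ge0_integralZl//.
- apply/measurable_EFinP; apply: open_continuous_measurable_fun => // s.
  by rewrite inE /= in_itv /= andbT; exact: cD.
- by move=> s _; rewrite lee_fin invr_ge0 addr_ge0 ?sqrtr_ge0 ?powR_ge0.
- by rewrite lee_fin invr_ge0 ltW.
Qed.

(** The strict inequality leaves room to choose [m < 1] with [Psi a / m] still
    below the distance to the boundary; [u] is bounded on the closed ball of
    that radius, and [phi] exceeds the bound before reaching it. *)
Lemma subsolution_le (x : 'rV[R]_n) (a : R) : (0 < n)%N -> Omega x -> 0 < a ->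
  C^-1 * psi f g q a < dist_boundary Omega x -> u x <= a.
Proof.
move=> n0 Ox a0.
set P := C^-1 * _; set d := dist_boundary _ _ => Pd.
have [C0 _] := C_bound.
have P0 : 0 < P by rewrite mulr_gt0 ?invr_gt0 ?(psi_gt0 q2 fg KO).
have d0 : 0 < d by exact: lt_trans Pd.
(* a contraction factor strictly between [P / d] and [1] *)
pose m := (P / d + 1) / 2.
have Pd1 : P / d < 1 by rewrite ltr_pdivrMr// mul1r.
have Pd0 : 0 < P / d by rewrite divr_gt0.
have m0 : 0 < m by rewrite /m; lra.
have m1 : m < 1 by rewrite /m; lra.
have Pm : P / d < m by rewrite /m; lra.
pose b := P / m.
have bd : b < d by rewrite /b ltr_pdivrMr// mulrC -ltr_pdivrMr.
have bO : eball x b `<=` Omega.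
  by move=> y yb; apply: (lt_dist_boundary Omega_open Ox); exact: le_lt_trans bd.
have bx : eball x b !=set0.
  by exists x; rewrite /eball /= subrr enorm0 divr_ge0// ltW.
have [M uM] := usc_bounded u_sub (@eball_compact _ _ x b) bx bO.
have m20 : 0 < m ^+ 2 by rewrite exprn_gt0.
have fgm := nondecreasing_cont_sign_scale m20 fg.
have [r0 [phi [phi1 [r00 Mphi [phi_0 phi1_0] dphi phi1_gt0]]]] := ivp_exists q0 q2 fgm a0 M.
have dphi0 r : 0 <= r <= r0 -> is_derive r 1 phi (phi1 r) by move=> /dphi[].
have dphi1 r : 0 <= r <= r0 ->
    is_derive r 1 phi1 (m ^+ 2 * f (phi r) + g (phi r) * `|phi1 r| `^ q).
  by move=> /dphi[].
have r0b : r0 <= b.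
  exact: (blowup_radius_le m0 (ltW m1) a0 r00 phi_0 phi1_0 dphi0 dphi1 phi1_gt0).
have sub : eball x r0 `<=` eball x b by move=> y yr; exact: le_trans r0b.
have m21 : m ^+ 2 < 1 by rewrite expr_lt1// ltW.
apply: (comparison n0 fg u_sub m20 m21 a0 r00 phi_0 phi1_0 dphi0 dphi1 phi1_gt0
  _ _ Mphi) => y /sub yb; [exact: bO|exact: uM].
Qed.

Lemma Psi_decr (t t' : R) : 0 < t -> t < t' ->
  (Psi f g q C t' < Psi f g q C t)%E.
Proof.
move=> t0 tt'; have [C0 _] := C_bound.
rewrite (PsiE q2 fg KO C t0) (PsiE q2 fg KO C (lt_trans t0 tt')) lte_fin.
rewrite ltr_pM2l ?invr_gt0//.
exact: (psi_decr q2 fg KO).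
Qed.

Lemma Psi0E : Psi0 f g q C = ereal_sup (Psi f g q C @` [set` `]0%R, +oo[]).
Proof.
have nd : {in Interval (BRight (0 : R)) +oo%O &, nonincreasing_fun (Psi f g q C)}.
  move=> s t; rewrite !in_itv /= !andbT => s0 t0.
  by rewrite le_eqVlt => /predU1P[->//|st]; exact/ltW/Psi_decr.
have b0 : (BRight (0 : R) < +oo%O)%O by [].
exact: (cvg_lim _ (nonincreasing_at_right_cvge _ b0 nd)).
Qed.

Lemma Psi_lt_Psi0 (t : R) : 0 < t -> (Psi f g q C t < Psi0 f g q C)%E.
Proof.
move=> t0; have t20 : 0 < t / 2 by rewrite divr_gt0.
have tt : t / 2 < t by rewrite ltr_pdivrMr// ltr_pMr// ltr1n.
apply: lt_le_trans (Psi_decr t20 tt) _.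
rewrite Psi0E; apply: ereal_sup_ubound; exists (t / 2) => //=.
by rewrite in_itv /= t20.
Qed.

Hypothesis growth : unbounded_above f \/ unbounded_above g.

(** Intermediate value theorem between a point where [Psi] exceeds [d] and a
    point far out where it is below [d]. *)
Lemma Psi_inverse (d : R) : 0 < d -> (d%:E < Psi0 f g q C)%E ->
  exists s, 0 < s /\ Psi f g q C s = d%:E.
Proof.
move=> d0; have [C0 _] := C_bound.
rewrite Psi0E => /ereal_sup_gt[_ [t1 /= + <-]]; rewrite in_itv /= andbT => t10.
rewrite (PsiE q2 fg KO)// lte_fin => dt1.
have [t2 t20 t2d] := psi_small q2 fg KO growth (mulr_gt0 C0 d0).
have {}t2d : C^-1 * psi f g q t2 < d by rewrite mulrC ltr_pdivrMr// mulrC.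
have t12 : t1 < t2.
  rewrite ltNge le_eqVlt; apply/negP => /predU1P[E|t21].
    by move: dt1; rewrite -E ltNge (ltW t2d).
  have cmp : C^-1 * psi f g q t1 < C^-1 * psi f g q t2.
    by rewrite ltr_pM2l ?invr_gt0//; exact: (psi_decr q2 fg KO t20 t21).
  by have := lt_trans (lt_trans dt1 cmp) t2d; rewrite ltxx.
have cP : {within `[t1, t2], continuous (fun t => C^-1 * psi f g q t)}.
  apply: continuous_in_subspaceT => t /set_mem /=; rewrite in_itv /= => /andP[t1t _].
  apply: cvgM; first exact: cvg_cst.
  by apply: (@psi_continuous _ _ _ _ q2 fg KO t); exact: lt_le_trans t1t.
have ivt (P : R -> R) : {within `[t1, t2], continuous P} -> d < P t1 -> P t2 < d ->
    exists2 s, s \in `[t1, t2]%R & P s = d.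
  move=> cP' d1 d2; apply: (IVT (ltW t12) cP').
  by rewrite ge_min (ltW d2) orbT le_max (ltW d1).
have [s] := ivt _ cP dt1 t2d.
rewrite in_itv /= => /andP[t1s _] E; have s0 := lt_le_trans t10 t1s.
by exists s; split=> //; rewrite (PsiE q2 fg KO)// E.
Qed.

End estimate.

Theorem proposition3p6 (R : realType) (n : nat) (Omega : set 'rV[R]_n)
    (q C : R) (f g : R -> R) (u : 'rV[R]_n -> R)
    (Omega_open : open Omega)
    (Omega_boundary : boundary Omega !=set0)
    (q_gt0 : 0 < q) (q_lt2 : q < 2)
    (C_bound : gradient_bound_constant q C)
    (fg : nondecreasing_cont_sign f g)
    (KO : keller_osserman f g q)
    (fg_infty : 1 < q ->
      (f t @[t --> +oo] --> +oo) \/ (g t @[t --> +oo] --> +oo))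
    (u_sub : viscosity_subsolution f g q Omega u) :
  forall x, Omega x -> u x <= calQ f g q C (dist_boundary Omega x).
Proof.
move=> x Ox.
set d := dist_boundary Omega x.
have d0 : 0 < d by exact: dist_boundary_gt0.
have n0 : (0 < n)%N.
  rewrite lt0n; apply/eqP => n_eq0; case: Omega_boundary => y [_ []].
  apply: open_nbhs_nbhs; split=> //; rewrite (_ : y = x)//.
  by apply/rowP => -[i ilt]; exfalso; move: ilt; rewrite n_eq0.
have growth : unbounded_above f \/ unbounded_above g.
  have [/(KO_unbounded q_lt2 fg KO)//|/fg_infty q1] := leP q 1.
  have lim_unbounded (h : R -> R) : h t @[t --> +oo] --> +oo -> unbounded_above h.
    move=> /cvgryPge hy A; have [M [_ hM]] := hy A.
    by exists (M + 1); apply: hM; rewrite ltrDl.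
  by case: q1 => /lim_unbounded; [left|right].
have below (a : R) : 0 < a -> (Psi f g q C a < d%:E)%E -> u x <= a.
  move=> a0; rewrite (PsiE q_lt2 fg KO)// lte_fin.
  exact: (subsolution_le Omega_open q_gt0 q_lt2 C_bound fg KO u_sub).
have below_all (s : R) : 0 <= s ->
    (forall a, s < a -> (Psi f g q C a < d%:E)%E) -> u x <= s.
  move=> s0 sa; apply/ler_addgt0Pr => e e0.
  have se : s < s + e by rewrite ltrDl.
  by apply: below (sa _ se); exact: le_lt_trans se.
rewrite /calQ /Phi; case: ifPn => [/eqP dPsi0|].
  apply: below_all => // a a0; apply: (@lt_le_trans _ _ (Psi0 f g q C)).
    exact: (Psi_lt_Psi0 q_lt2 C_bound fg KO).
  by rewrite -dPsi0 ge_min lexx.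
case: (ltP d%:E (Psi0 f g q C)) => [dPsi0 _|]; last by rewrite eqxx.
have [s0 Es] := xgetPex 0 (Psi_inverse q_lt2 C_bound fg KO growth d0 dPsi0).
apply: below_all => [|a sa]; first exact: ltW.
by rewrite -Es; exact: (Psi_decr q_lt2 C_bound fg KO).
Qed.
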